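(* Let $p,q\ge0$ with $p+q\ge 1$ and $d\ge2$ be integers. Then $J^{\mathcal A}_1,\dots,J^{\mathcal A}_{p+q}$ is a Jucys--Murphy sequence for the family $\mathcal A=(\mathcal A_0,\dots,\mathcal A_{p+q})$ of matrix algebras of partially transposed permutations; that is, for all $k\in\{1,\dots,p+q\}$: $J^{\mathcal A}_k\in\mathcal X^{\mathcal A}_k$, $J^{\mathcal A}_1+\dots+J^{\mathcal A}_k\in Z(\mathcal A_k)$, and $\mathcal X^{\mathcal A}_k=\langle J^{\mathcal A}_1,\dots,J^{\mathcal A}_k\rangle$.
   Context: Let $V=\mathbb C^d$ and $V^{p,q}=V^{\otimes p}\otimes (V^* )^{\otimes q}$, identified with $(\mathbb C^d)^{\otimes(p+q)}$ with its standard basis. A walled Brauer diagram has two rows (top and bottom) of $p+q$ nodes, with a wall between the first $p$ and the last $q$ columns; the $2(p+q)$ nodes are perfectly matched so that two matched nodes in the same row lie on different sides of the wall and two matched nodes in different rows lie on the same side. $\mathcal B^d_{p,q}$ is the complex algebra with basis these diagrams and product $\rho\sigma$ given by stacking $\rho$ on top of $\sigma$, identifying the bottom row of $\rho$ with the top row of $\sigma$, deleting each closed loop and multiplying by $d$ per loop. The representation $\psi^d_{p,q}:\mathcal B^d_{p,q}\to\mathrm{End}(V^{p,q})$ is defined on a diagram $\sigma$ by: $\langle x_1,\dots,x_{p+q}|\psi^d_{p,q}(\sigma)|y_1,\dots,y_{p+q}\rangle$ equals $1$ if, after labelling the top nodes by $x_1,\dots,x_{p+q}$ and the bottom nodes by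 $y_1,\dots,y_{p+q}$, all matched pairs carry equal labels, and $0$ otherwise. For $0\le k\le p+q$ let $\mathcal B_k=\mathbb C$ if $k=0$, $\mathcal B_k=\mathcal B^d_{k,0}$ if $1\le k\le p$, $\mathcal B_k=\mathcal B^d_{p,k-p}$ if $p<k\le p+q$, embedded in $\mathcal B^d_{p,q}$ by adding vertical edges on the right, and $\mathcal A_k=\psi^d_{p,q}(\mathcal B_k)\subseteq\mathrm{End}(V^{p,q})$. Write $Z(\cdot)$ for the center, $\langle\cdot\rangle$ for the generated unital subalgebra, and $\mathcal X^{\mathcal A}_k=\langle Z(\mathcal A_1),\dots,Z(\mathcal A_k)\rangle$ (Gelfand--Tsetlin subalgebra). For columns $i\ne k$ on the same side of the wall, $\sigma_{i,k}$ is the transposition diagram of $i$ and $k$; for $i\le p<k$, $\bar\sigma_{i,k}$ is the contraction diagram matching $i$ with $k$ in the top row and $i$ with $k$ in the bottom row; in both all other columns are vertical edges. Set $$J^{\mathcal B}_k=\sum_{i=1}^{k-1}\sigma_{i,k}\ \ (1\le k\le p),\qquad J^{\mathcal B}_k=\sum_{i=p+1}^{k-1}\sigma_{i,k}-\sum_{i=1}^{p}\bar\sigma_{i,k}+d\ \ (p+1\le k\le p+q),$$ and $J^{\mathcal A}_k=\psi^d_{p,q}(J^{\mathcal B}_k)$. A sequence $J_1,\dots,J_{p+q}$ with $J_k\in\mathcal X^{\mathcal A}_k$ for all $k$ is additively central if $J_1+\dots+J_k\in Z(\mathcal A_k)$ for all $k$, separating if $\mathcal X^{\mathcal A}_k=\langle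 J_1,\dots,J_k\rangle$ for all $k$, and a Jucys--Murphy sequence if it is both. *)

(* Defs.v *)
From HB Require Import structures.
From mathcomp Require Import all_boot all_order all_algebra all_field.
From mathcomp Require Import reals complex.

Set Implicit Arguments.
Unset Strict Implicit.
Unset Printing Implicit Defensive.

Import GRing.Theory.

Local Open Scope ring_scope.

(* A node is a pair (row, column), where the row is true for top. *)
Definition node (n : nat) : Type := (bool * 'I_n)%type.

HB.instance Definition _ n := Finite.copy (node n) (bool * 'I_n)%type.

(* The wall sits after the first p of the n columns. *)
Definition left_of_wall (p n : nat) (i : 'I_n) : bool := (i < p)%N.

(* Matched nodes are exchanged by f. *)
Definition perfect_matching (n : nat) (f : {ffun node n -> node n}) : bool :=
  [forall v, (f v != v) && (f (f v) == v)].

Definition respects_wall (p n : nat) (f : {ffun node n -> node n}) : bool :=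
  [forall v : node n,
     if (f v).1 == v.1 then left_of_wall p (f v).2 != left_of_wall p v.2
     else left_of_wall p (f v).2 == left_of_wall p v.2].

(* Walled Brauer diagrams with n columns and the wall after column p. With    *)
(* n = p + q these are the (p,q)-diagrams; if n <= p every column is on the   *)
(* left of the wall, so they are the (n,0)-diagrams, i.e. the permutations.   *)
Record diagram (p n : nat) : Type := Diagram {
  matching :> {ffun node n -> node n};
  _ : perfect_matching matching && respects_wall p matching }.

HB.instance Definition _ p n := [isSub for @matching p n].
HB.instance Definition _ p n := [Finite of diagram p n by <:].

Definition raw_vertical (n : nat) : {ffun node n -> node n} :=
  [ffun v => (~~ v.1, v.2)].

Definition raw_transposition (n : nat) (i k : 'I_n) : {ffun node n -> node n} :=
  [ffun v => (~~ v.1, if v.2 == i then k else if v.2 == k then i else v.2)].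

Definition raw_contraction (n : nat) (i k : 'I_n) : {ffun node n -> node n} :=
  [ffun v => if v.2 == i then (v.1, k) else if v.2 == k then (v.1, i)
             else (~~ v.1, v.2)].

Fact vertical_subproof p n :
  perfect_matching (raw_vertical n) && respects_wall p (raw_vertical n).
Proof.
apply/andP; split; apply/forallP => -[r j]; rewrite !ffunE /=;
  last by case: r => /=; rewrite eqxx.
by rewrite negbK eqxx andbT xpair_eqE; case: r.
Qed.

Definition vertical (p n : nat) : diagram p n := Diagram (vertical_subproof p n).

(* The defaults are never used when i and k are on the required sides of the  *)
(* wall, see transpositionE and contractionE.                                 *)
Definition transposition (p n : nat) (i k : 'I_n) : diagram p n :=
  insubd (vertical p n) (raw_transposition i k).

Definition contraction (p n : nat) (i k : 'I_n) : diagram p n :=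
  insubd (vertical p n) (raw_contraction i k).

Lemma transpositionE (p n : nat) (i k : 'I_n) :
  left_of_wall p i = left_of_wall p k ->
  transposition p i k = raw_transposition i k :> {ffun node n -> node n}.
Proof.
move=> sik; rewrite /transposition; apply: insubdK; apply/andP; split.
  apply/forallP => -[r j]; rewrite !ffunE /= negbK; apply/andP; split.
    by rewrite xpair_eqE; case: r.
  apply/eqP; congr (_, _); case: (eqVneq j i) => [->|nji].
    by case: (eqVneq k i) => [->|_]; rewrite ?eqxx.
  by case: (eqVneq j k) => [->|/negPf->]; rewrite ?eqxx // (negPf nji).
apply/forallP => -[r j]; rewrite !ffunE /=.
have -> : (~~ r == r) = false by case: r.
case: (eqVneq j i) => [->|_]; first by rewrite sik.
by case: (eqVneq j k) => [->|_]; rewrite ?sik.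
Qed.

Lemma contractionE (p n : nat) (i k : 'I_n) :
  left_of_wall p i != left_of_wall p k ->
  contraction p i k = raw_contraction i k :> {ffun node n -> node n}.
Proof.
move=> sik; have nik : k != i by apply: contraNneq sik => ->.
rewrite /contraction; apply: insubdK; apply/andP; split;
  apply/forallP => -[r j]; rewrite !ffunE /=.
  case: (eqVneq j i) => [->|nji] /=.
    by rewrite (negPf nik) !eqxx /= xpair_eqE eqxx (negPf nik).
  case: (eqVneq j k) => [->|njk] /=.
    by rewrite eqxx xpair_eqE eqxx eq_sym nik /=.
  by rewrite (negPf nji) (negPf njk) negbK eqxx xpair_eqE; case: r.
case: (eqVneq j i) => [->|nji] /=; first by rewrite eqxx eq_sym.
case: (eqVneq j k) => [->|njk] /=; first by rewrite eqxx.
by case: r => /=; rewrite eqxx.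
Qed.

(* Adding vertical edges on the right, from m to n columns. *)
Definition raw_embed (m n : nat) (le_mn : (m <= n)%N)
    (f : {ffun node m -> node m}) : {ffun node n -> node n} :=
  [ffun v => if insub (val v.2) is Some j
             then ((f (v.1, j)).1, widen_ord le_mn (f (v.1, j)).2)
             else (~~ v.1, v.2)].

Fact embed_subproof (p m n : nat) (le_mn : (m <= n)%N) (s : diagram p m) :
  perfect_matching (raw_embed le_mn s) && respects_wall p (raw_embed le_mn s).
Proof.
case: s => f /= /andP[/forallP pf /forallP wf].
apply/andP; split; apply/forallP => -[r i]; rewrite !ffunE /=.
  case: insubP => [j lt_im def_j|ge_im] /=; last first.
    by rewrite insubN //= negbK eqxx xpair_eqE; case: r.
  rewrite (_ : insub _ = Some (f (r, j)).2); last first.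
    by rewrite insubT //= => lt; congr Some; apply: val_inj.
  rewrite -surjective_pairing; have /andP[nf /eqP->] := pf (r, j).
  apply/andP; split; last by rewrite xpair_eqE -val_eqE /= def_j !eqxx.
  apply: contra nf; case: (f (r, j)) => a b /=.
  by rewrite !xpair_eqE -!val_eqE /= def_j.
case: insubP => [j lt_im def_j|ge_im] /=.
  by have := wf (r, j); rewrite /left_of_wall /= def_j.
by case: r => /=; rewrite eqxx.
Qed.

Definition embed (p m n : nat) (le_mn : (m <= n)%N) (s : diagram p m) :
  diagram p n := Diagram (embed_subproof le_mn s).

Section WalledBrauer.
Variable R : realType.
Local Notation C := R[i].

(* The underlying vector space of the walled Brauer algebra. Its product does *)
(* not enter below: products are taken in End(V^{p,q}), on the images of psi. *)
Definition brauer (p n : nat) : vectType C := {ffun diagram p n -> C^o}.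

Definition basis_vec (p n : nat) (s : diagram p n) : brauer p n :=
  [ffun t => (t == s)%:R].

Definition brauer_embed_fun (p m n : nat) (le_mn : (m <= n)%N)
    (b : brauer p m) : brauer p n :=
  \sum_s b s *: basis_vec (embed le_mn s).

Fact brauer_embed_linear p m n (le_mn : (m <= n)%N) :
  linear (@brauer_embed_fun p m n le_mn).
Proof.
move=> a u v; rewrite /brauer_embed_fun scaler_sumr -big_split /=.
by apply: eq_bigr => s _; rewrite !ffunE scalerDl scalerA.
Qed.

HB.instance Definition _ p m n (le_mn : (m <= n)%N) :=
  GRing.isLinear.Build C (brauer p m) (brauer p n) _
    (@brauer_embed_fun p m n le_mn) (brauer_embed_linear le_mn).

Definition brauer_embed (p m n : nat) (le_mn : (m <= n)%N) :
  'Hom(brauer p m, brauer p n) := linfun (@brauer_embed_fun p m n le_mn).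

(* Labels of the standard basis of the n-fold tensor power of C^d. *)
Definition word (d n : nat) : finType := {ffun 'I_n -> 'I_d}.

(* End((C^d)^{(x) n}). The size is written as a successor since only then do  *)
(* matrices have an algebra structure; it is #|word d n| = d ^ n for d > 0.   *)
Definition endo (d n : nat) : falgType C := 'M[C]_(#|word d n|.-1.+1).

Definition ket (d n : nat) (x : word d n) : 'I_(#|word d n|.-1.+1) :=
  inord (enum_rank x).

Definition node_label (d n : nat) (x y : word d n) (v : node n) : 'I_d :=
  if v.1 then x v.2 else y v.2.

Definition compatible (p d n : nat) (s : diagram p n) (x y : word d n) : bool :=
  [forall v, node_label x y (s v) == node_label x y v].

Definition psi_diagram (p d n : nat) (s : diagram p n) : endo d n :=
  \sum_(x : word d n) \sum_(y : word d n | compatible s x y)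
     (delta_mx (ket x) (ket y) : 'M[C]_(#|word d n|.-1.+1)).

Definition psi_fun (p d n : nat) (b : brauer p n) : endo d n :=
  \sum_s b s *: psi_diagram d s.

Fact psi_linear p d n : linear (@psi_fun p d n).
Proof.
move=> a u v; rewrite /psi_fun scaler_sumr -big_split /=.
by apply: eq_bigr => s _; rewrite !ffunE scalerDl scalerA.
Qed.

HB.instance Definition _ p d n :=
  GRing.isLinear.Build C (brauer p n) (endo d n) _
    (@psi_fun p d n) (@psi_linear p d n).

Definition psi (p d n : nat) : 'Hom(brauer p n, endo d n) :=
  linfun (@psi_fun p d n).

Lemma psi_coefE p d n (s : diagram p n) (x y : word d n) : (0 < d)%N ->
  (psi p d n (basis_vec s) : 'M__) (ket x) (ket y) = (compatible s x y)%:R.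
Proof.
move=> hd; have c0 : (0 < #|word d n|)%N by rewrite card_ffun !card_ord expn_gt0 hd.
have kI : injective (@ket d n).
  move=> a b /(congr1 val); rewrite /ket /= !inordK; try by rewrite prednK.
  by move=> /val_inj; exact: enum_rank_inj.
rewrite lfunE /= /psi_fun (bigD1 s) //= big1 => [|t nt].
  rewrite addr0 !ffunE eqxx scale1r /psi_diagram summxE (bigD1 x) //=.
  rewrite [X in _ + X]big1 => [|z nz].
    rewrite addr0 summxE; case: (boolP (compatible s x y)) => h.
      rewrite (bigD1 y) //= mxE !eqxx [X in _ + X]big1 ?addr0 //.
      move=> z /andP[_ nz].
      by rewrite mxE !(inj_eq kI) [y == z]eq_sym (negPf nz) andbF.
    rewrite big1 // => z hz; rewrite mxE !(inj_eq kI).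
    case: (eqVneq y z) => [yz|_]; last by rewrite andbF.
    by rewrite yz hz in h.
  rewrite summxE big1 // => w _; rewrite mxE !(inj_eq kI) [x == z]eq_sym (negPf nz) //.
by rewrite !ffunE (negPf nt) scale0r.
Qed.

(* For k = 0 there is just the empty diagram, so that brauer p 0 is C and its *)
(* image consists of the scalar matrices.                                     *)
Definition algA (p q d : nat) (k : 'I_(p + q).+1) : {vspace endo d (p + q)} :=
  (psi p d (p + q) @: (brauer_embed p (leq_ord k) @: fullv))%VS.

(* Columns are numbered from 0: JB k is the element of index k + 1 in the     *)
(* 1-based numbering.                                                         *)
Definition JB (p q d : nat) (k : 'I_(p + q)) : brauer p (p + q) :=
  if (k < p)%N then
    \sum_(i < p + q | (i < k)%N) basis_vec (transposition p i k)
  else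
    \sum_(i < p + q | (p <= i < k)%N) basis_vec (transposition p i k)
    - \sum_(i < p + q | (i < p)%N) basis_vec (contraction p i k)
    + d%:R *: basis_vec (vertical p (p + q)).

Definition JA (p q d : nat) (k : 'I_(p + q)) : endo d (p + q) :=
  psi p d (p + q) (JB d k).

End WalledBrauer.

(* For a family A_0, ..., A_n of subspaces of an algebra and a sequence       *)
(* J_1, ..., J_n; the latter is indexed by 'I_n, and J_(k+1) = J k goes with  *)
(* A_(k+1) = A (lift ord0 k).                                                 *)
Section JucysMurphy.
Variables (K : fieldType) (E : falgType K) (n : nat).
Implicit Types (A : 'I_n.+1 -> {vspace E}) (J : 'I_n -> E).

Definition gelfand_tsetlin A (k : 'I_n.+1) : {vspace E} :=
  agenv (\sum_(i < n.+1 | (0 < i <= k)%N) 'Z(A i))%VS.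

Definition additively_central A J : Prop :=
  forall k : 'I_n, \sum_(i < n | (i <= k)%N) J i \in 'Z(A (lift ord0 k))%VS.

Definition separating A J : Prop :=
  forall k : 'I_n,
    gelfand_tsetlin A (lift ord0 k)
    = agenv <<[seq J i | i : 'I_n <- enum 'I_n & (i <= k)%N]>>%VS.

Definition jucys_murphy A J : Prop :=
  [/\ forall k : 'I_n, J k \in gelfand_tsetlin A (lift ord0 k),
      additively_central A J
    & separating A J].

End JucysMurphy.

(* Main.v *)
(* An orthogonality argument replaces branching rules. Let E_ab act on the
   mixed tensor space as elements of gl_d. By the first fundamental theorem
   A_k is the commutant of gl_d acting on the first k factors and of the full
   matrix algebras on the other ones, and the bicommutant theorem applies. If
   x is in Z(A_k), then x commutes with A_{k-1}, hence lies in the algebra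
   generated by the operators Delta(E_ab) on the first k-1 factors and the
   matrix units e(a, b) of the k-th one. Being gl_d-invariant, x lifts modulo
   shorter products to an invariant tensor, that is a combination of
   permutations, applied to words Delta ... Delta e. If such a permutation does
   not link e to a Delta, the word collapses to an element of Z(A_{k-1});
   otherwise the linked Delta can be moved next to e, and summing over the
   shared index splits off the factor sum_ab Delta(E_ab) e(b, a), which is J_k
   up to a constant. By induction Z(A_k) is contained in <J_1, ..., J_k>.
   Finally J_1 + ... + J_k is half the Casimir operator plus a constant. *)
Require Import Defs.
From HB Require Import structures.
From mathcomp Require Import all_boot all_order all_algebra all_fingroup all_field.
From mathcomp Require Import reals complex.

Set Implicit Arguments.
Unset Strict Implicit.
Unset Printing Implicit Defensive.

Import Order.TTheory GRing.Theory Num.Theory.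

Local Open Scope ring_scope.

(** For d < p + q the map [psi] has a kernel, so all arguments live inside matrix algebras. The wall
    is removed by transposing the factors to its right: a diagram becomes a permutation, and the
    mixed action of gl_d becomes the ordinary diagonal one, up to a sign and a swap of indices. The
    parameter [t] of [gl_op] selects the side of the wall on which the factors are C^d. Both choices
    have the same commutant, so at column [c] the choice [t = left c] is free; it makes the last
    column act by its own matrix units, and one argument serves both sides of the wall. The main
    obstacle is that products of the operators Delta(E_ab) satisfy relations: an invariant word need
    not come from an invariant tensor in an evident way. Words are therefore filtered by their
    number of letters, reordering letters only costs shorter words, and the invariant tensor is
    selected by the Hilbert-Schmidt form, for which the adjoint of E_ab acting on tensors is
    E_ba. *)

Section Bicommutant.
Variables (C : numClosedFieldType) (N : nat).
Local Notation E := 'M[C]_N.+1.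
Implicit Types (K : {vspace E}) (x y z : E).

(** * The Hilbert-Schmidt form and the bicommutant theorem *)

Definition adjoint x : E := map_mx Num.conj x^T.

Lemma adjointD x y : adjoint (x + y) = adjoint x + adjoint y.
Proof. by rewrite /adjoint linearD /= map_mxD. Qed.

Lemma adjointZ a x : adjoint (a *: x) = a^* *: adjoint x.
Proof. by rewrite /adjoint linearZ /= map_mxZ. Qed.

Lemma adjointM x y : adjoint (x * y) = adjoint y * adjoint x.
Proof. by rewrite /adjoint -!mulmxE trmx_mul map_mxM. Qed.

Lemma adjointK : involutive adjoint.
Proof. by move=> x; apply/matrixP => i j; rewrite !mxE conjCK. Qed.

Lemma adjoint_sum I (r : seq I) (P : pred I) (F : I -> E) :
  adjoint (\sum_(i <- r | P i) F i) = \sum_(i <- r | P i) adjoint (F i).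
Proof.
apply: (big_morph adjoint adjointD).
by apply/matrixP => i j; rewrite !mxE conjC0.
Qed.

(** The Hilbert-Schmidt form, conjugate-linear in the first argument. *)
Definition hs x y : C := \tr (adjoint x * y).

Lemma hsDr x y z : hs x (y + z) = hs x y + hs x z.
Proof. by rewrite /hs mulrDr linearD. Qed.

Lemma hsZr a x y : hs x (a *: y) = a * hs x y.
Proof. by rewrite /hs -scalerAr linearZ. Qed.

Lemma hsBr x y z : hs x (y - z) = hs x y - hs x z.
Proof. by rewrite /hs mulrBr linearB. Qed.

Lemma hsDl x y z : hs (x + y) z = hs x z + hs y z.
Proof. by rewrite /hs adjointD mulrDl linearD. Qed.

Lemma hsZl a x y : hs (a *: x) y = a^* * hs x y.
Proof. by rewrite /hs adjointZ -scalerAl linearZ. Qed.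

Lemma hsMl x y z : hs (x * y) z = hs y (adjoint x * z).
Proof. by rewrite /hs adjointM mulrA. Qed.

Lemma hsMr x y z : hs (x * y) z = hs x (z * adjoint y).
Proof. by rewrite /hs adjointM -mulrA [LHS]mxtrace_mulC !mulmxE mulrA. Qed.

Lemma hsC x y : hs x y = (hs y x)^*.
Proof.
rewrite /hs -{1}[y]adjointK -adjointM /mxtrace rmorph_sum /=.
by apply: eq_bigr => i _; rewrite !mxE.
Qed.

Lemma hs_eq0 x : hs x x = 0 -> x = 0.
Proof.
rewrite /hs /mxtrace => h.
have ge0 (i j : 'I_N.+1) : 0 <= (x j i)^* * x j i.
  by rewrite mulrC mul_conjC_ge0.
have E1 (i : 'I_N.+1) : (adjoint x * x) i i = \sum_j (x j i)^* * x j i.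
  by rewrite -mulmxE mxE; apply: eq_bigr => j _; rewrite !mxE.
have {}h i : (adjoint x * x) i i = 0.
  by apply: (psumr_eq0P _ h) => // k _; rewrite E1 sumr_ge0.
apply/matrixP => j i; rewrite mxE; apply/eqP.
rewrite -mul_conjC_eq0 mulrC; apply/eqP.
by move: (h i); rewrite E1 => /(psumr_eq0P (fun j _ => ge0 i j)) ->.
Qed.

Lemma hs0l y : hs 0 y = 0.
Proof. by rewrite -(scale0r 0) hsZl conjC0 mul0r. Qed.

(** Gram-Schmidt along a basis of [K]: each vector [v] adds the rank-one projection onto
    [v1 = v - P v]. The projection is produced as a linear map because [bicommutant] cuts it into
    blocks. *)
Lemma orthogonal_projection K : exists P : 'End(E),
  forall y, (P y \in K) /\ (forall z, z \in K -> hs z (y - P y) = 0).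
Proof.
rewrite -(span_basis (vbasisP K)); move: (tval (vbasis K)); elim=> [|v X [P IH]].
  exists 0; move=> y; rewrite lfunE /= mem0v; split=> // z.
  by rewrite span_nil memv0 => /eqP ->; rewrite hs0l.
pose v1 := v - P v.
have [Pv ov] := IH v; have v1X z : z \in <<X>>%VS -> hs z v1 = 0 by exact: ov.
have v1K : v1 \in <<v :: X>>%VS.
  rewrite span_cons addvC; apply: rpredB.
    exact: (subvP (addvSr _ _)) (memv_line v).
  exact: (subvP (addvSl _ _)).
have lin : linear (fun y => (hs v1 y / hs v1 v1) *: v1).
  by move=> a y z; rewrite hsDr hsZr mulrDl scalerDl -mulrA scalerA.
pose q := GRing.isLinear.Build C E E _ (fun y => (hs v1 y / hs v1 v1) *: v1) lin.
pose g : {linear E -> E} := HB.pack (fun y => (hs v1 y / hs v1 v1) *: v1) q.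
pose Q : 'End(E) := linfun g.
have QE y : Q y = (hs v1 y / hs v1 v1) *: v1 by rewrite /Q (lfunE g).
have v10 z : hs z v1 = 0 -> hs v1 z = 0 by rewrite (hsC v1) => ->; rewrite conjC0.
exists (P + Q)%VF => y; have [Py oy] := IH y.
rewrite add_lfunE QE; split.
  rewrite rpredD ?rpredZ // span_cons addvC.
  exact: (subvP (addvSl _ _)).
have oX z : z \in <<X>>%VS -> hs z (y - (P y + (hs v1 y / hs v1 v1) *: v1)) = 0.
  by move=> zX; rewrite opprD addrA hsBr oy // hsZr (v1X z) // mulr0 subrr.
move=> z; rewrite span_cons => /memv_addP[_ /vlineP[a ->]] [z' z'X ->].
have vE : v = v1 + P v by rewrite subrK.
rewrite hsDl (oX _ z'X) addr0 hsZl vE hsDl (oX _ Pv) addr0.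
rewrite opprD addrA [hs v1 _]hsBr hsZr [hs v1 (y - _)]hsBr.
rewrite (v10 (P y) (v1X _ Py)) subr0.
(* If [hs v1 v1 = 0], then [v1 = 0] and [v] was already in the span; the quotient by zero is 0, so
   [Q] adds nothing. *)
have [v0|v0] := eqVneq (hs v1 v1) 0.
  by rewrite (hs_eq0 v0) !hs0l mul0r mul0r subrr mulr0.
by rewrite divfK // subrr mulr0.
Qed.

Lemma orthogonal_decomposition K y :
  exists y0 y1, [/\ y = y0 + y1, y0 \in K & forall z, z \in K -> hs z y1 = 0].
Proof.
have [P /(_ y)[Py oy]] := orthogonal_projection K.
by exists (P y), (y - P y); rewrite addrC subrK.
Qed.

(* The orthogonal projection onto the generated algebra, viewed as an
   operator on 'M_N = C^N (x) C^N, commutes with left multiplication by X, so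
   its blocks p j l lie in the commutant of X; hence x commutes with it. *)
Lemma bicommutant (X : seq E) :
  (forall u, u \in X -> adjoint u \in X) ->
  forall x, (forall t, (forall u, u \in X -> t * u = u * t) -> x * t = t * x) ->
  x \in agenv <<X>>%VS.
Proof.
move=> adX x xC; set B := agenv _.
have [P PP] := orthogonal_projection B.
have BX u b : u \in X -> b \in B -> u * b \in B.
  move=> uX bB; rewrite /B agenvEl; apply: (subvP (addvSr _ _)).
  by apply: memv_mul => //; exact: memv_span.
have B1 : 1 \in B by rewrite (subvP (sub1_agenv _)) // memv_line.
have P0 y : (forall z, z \in B -> hs z y = 0) -> P y = 0.
  move=> oy; apply: hs_eq0; have [Py opy] := PP y.
  by rewrite -{2}[P y](subKr y) hsBr oy // opy // subrr.
have Pid y : y \in B -> P y = y.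
  move=> yB; apply/esym/eqP; rewrite -subr_eq0; apply/eqP/hs_eq0.
  by have [Py ->] := PP y; rewrite ?rpredB.
(* Both [u] and its adjoint preserve [B], hence [u] preserves the orthogonal complement of [B] as
   well. *)
have PX u y : u \in X -> P (u * y) = u * P y.
  move=> uX; have [Py oy] := PP y.
  rewrite -{1}(subrK (P y) y) mulrDr linearD /= [X in _ + X]Pid ?BX //.
  rewrite P0 ?add0r // => z zB; rewrite -[u]adjointK -hsMl oy //.
  by rewrite BX // adX.
pose p j l : E := \matrix_(k, m) P (delta_mx m j) k l.
have pE j l v : p j l *m v = P (v *m delta_mx 0 j) *m delta_mx l (0 : 'I_1).
  have -> : v *m delta_mx 0 j = \sum_m v m 0 *: delta_mx m j :> E.
    apply/matrixP => a b; rewrite mxE big_ord1 summxE (bigD1 a) //= big1.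
      by rewrite !mxE !eqxx addr0.
    by move=> m ma; rewrite !mxE eq_sym (negPf ma) mulr0.
  rewrite linear_sum /= mulmx_suml; apply/colP => k; rewrite mxE summxE.
  apply: eq_bigr => m _; rewrite linearZ /= -scalemxAl !mxE mulrC; congr (_ * _).
  rewrite (bigD1 l) //= big1 ?addr0; first by rewrite !mxE !eqxx mulr1.
  by move=> i il; rewrite !mxE (negPf il) mulr0.
have pX j l u : u \in X -> p j l * u = u * p j l.
  move=> uX; apply/matrixP => a b.
  have := pE j l (u *m delta_mx b 0); rewrite -[_ *m _ *m delta_mx 0 j]mulmxA.
  rewrite mul_delta_mx [P _](PX u) // -mulmxE -(mulmxA u).
  have dE : delta_mx b j = delta_mx b (0 : 'I_1) *m delta_mx 0 j :> E.
    by rewrite mul_delta_mx.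
  rewrite dE -pE !mulmxA -!colE => /colP/(_ a).
  by rewrite !mxE.
(* As [x] commutes with all blocks of [P], one gets [P x = x * P 1], and [P 1 = 1] because [1] lies
   in [B]. *)
suff <- : P x = x by have [] := PP x.
apply/matrixP => a l.
have -> : P x = \sum_j P (x *m delta_mx j 0 *m delta_mx (0 : 'I_1) j).
  rewrite -linear_sum /=; congr (P _).
  under eq_bigr do rewrite -mulmxA mul_delta_mx.
  rewrite -mulmx_sumr -[LHS]mulmx1; congr (_ *m _).
  apply/matrixP => i j; rewrite summxE (bigD1 i) //= big1.
    by rewrite !mxE eqxx addr0 eq_sym.
  by move=> k ki; rewrite !mxE eq_sym (negPf ki).
have mxl (M : E) : M a l = (M *m delta_mx l (0 : 'I_1)) a 0 by rewrite -colE mxE.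
rewrite mxl mulmx_suml.
under eq_bigr => j _.
  rewrite -pE mulmxA mulmxE -xC; last by move=> u uX; rewrite pX.
  rewrite -mulmxE -mulmxA pE mul_delta_mx.
over.
rewrite -mulmx_sumr -mulmx_suml -linear_sum /= mulmxA.
have -> : \sum_(i < N.+1) delta_mx i i = 1 :> E.
  apply/matrixP => i j; rewrite summxE (bigD1 i) //= big1.
    by rewrite !mxE eqxx addr0 eq_sym.
  by move=> k ki; rewrite !mxE eq_sym (negPf ki).
by rewrite Pid // mulmx1 -mxl.
Qed.

End Bicommutant.

(** * Matrix units and permutation operators on the tensor power *)

Section Operators.
Variables (R : realType) (d : nat).
Hypothesis d_gt0 : (0 < d)%N.
Local Notation C := R[i].

Lemma natbM (b b' : bool) : b%:R * b'%:R = (b && b')%:R :> C.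
Proof. by case: b; rewrite ?mul1r ?mul0r. Qed.

Section Columns.
Variable n : nat.
Local Notation W := (word d n).
Local Notation E := (endo R d n).
Implicit Types (x y z u v : W) (i j k : 'I_n) (a b : 'I_d) (M N : E).

Lemma card_word_gt0 : (0 < #|W|)%N.
Proof. by rewrite card_ffun !card_ord expn_gt0 d_gt0. Qed.

Lemma ket_inj : injective (@ket d n).
Proof.
move=> x y /(congr1 val); rewrite /ket /= !inordK ?prednK ?card_word_gt0 //.
by move=> /val_inj; exact: enum_rank_inj.
Qed.

Lemma ket_bij : bijective (@ket d n).
Proof.
apply: inj_card_bij ket_inj _; by rewrite card_ord prednK // card_word_gt0.
Qed.

Definition entry M x y : C := (M : 'M__) (ket x) (ket y).

Lemma entryP M N : (forall x y, entry M x y = entry N x y) -> M = N.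
Proof.
have [f _ fK] := ket_bij; move=> MN; apply/matrixP => s t.
by rewrite -[s]fK -[t]fK; exact: MN.
Qed.

Lemma sum_ket (F : 'I_(#|W|.-1.+1) -> C) : \sum_s F s = \sum_x F (ket x).
Proof. by rewrite (reindex (@ket d n)) //; exact: onW_bij ket_bij. Qed.

Lemma entryM M N x y : entry (M * N) x y = \sum_z entry M x z * entry N z y.
Proof. by rewrite /entry -mulmxE mxE sum_ket. Qed.

Lemma entryD M N x y : entry (M + N) x y = entry M x y + entry N x y.
Proof. by rewrite /entry mxE. Qed.

Lemma entryZ (c : C) M x y : entry (c *: M) x y = c * entry M x y.
Proof. by rewrite /entry mxE. Qed.

Lemma entry_sum I (r : seq I) (P : pred I) (F : I -> E) x y :
  entry (\sum_(i <- r | P i) F i) x y = \sum_(i <- r | P i) entry (F i) x y.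
Proof. by rewrite /entry summxE. Qed.

Lemma entry1 x y : entry 1 x y = (x == y)%:R.
Proof. by rewrite /entry -[1]/(1%:M) mxE (inj_eq ket_inj). Qed.

Lemma entry_adjoint M x y : entry (adjoint M) x y = (entry M y x)^*.
Proof. by rewrite /entry !mxE. Qed.

Definition ketbra u v : E := delta_mx (ket u) (ket v).

Lemma entry_ketbra u v x y :
  entry (ketbra u v) x y = (x == u)%:R * (y == v)%:R.
Proof. by rewrite /entry mxE !(inj_eq ket_inj) natbM. Qed.

Definition operator (K : W -> W -> C) : E :=
  locked (\sum_u \sum_v K u v *: ketbra u v).

Lemma entry_operator K x y : entry (operator K) x y = K x y.
Proof.
rewrite /operator -lock entry_sum (bigD1 x) //= [X in _ + X]big1 ?addr0 => [|u ux].
  rewrite entry_sum (bigD1 y) //= big1 ?addr0 => [|v vy].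
    by rewrite entryZ entry_ketbra !eqxx !mulr1.
  by rewrite entryZ entry_ketbra [y == v]eq_sym (negPf vy) !mulr0.
rewrite entry_sum big1 // => v _.
by rewrite entryZ entry_ketbra eq_sym (negPf ux) mul0r mulr0.
Qed.

Lemma operator_entry M : M = \sum_u \sum_v entry M u v *: ketbra u v.
Proof.
rewrite [RHS]lock -/(operator (entry M)).
by apply: entryP => x y; rewrite entry_operator.
Qed.

Definition upd x j a : W := [ffun i => if i == j then a else x i].

Lemma upd_same x j a : upd x j a j = a. Proof. by rewrite ffunE eqxx. Qed.

Lemma upd_other x j a i : i != j -> upd x j a i = x i.
Proof. by move=> ij; rewrite ffunE (negPf ij). Qed.

Lemma upd_id x j : upd x j (x j) = x.
Proof. by apply/ffunP => i; rewrite ffunE; case: eqP => // ->. Qed.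

Lemma upd_upd x j a b : upd (upd x j a) j b = upd x j b.
Proof. by apply/ffunP => i; rewrite !ffunE; case: eqP. Qed.

Lemma upd_comm x i j a b : i != j -> upd (upd x i a) j b = upd (upd x j b) i a.
Proof.
move=> ij; apply/ffunP => k; rewrite !ffunE; case: (eqVneq k j) => // ->.
by rewrite eq_sym (negPf ij).
Qed.

(** The same relation between two words, read from either end; it converts row formulas for
    [unit_op] into column formulas and yields its adjoint. *)
Lemma eq_upd x y j a b : (x j == a) && (y == upd x j b) =
  (y j == b) && (x == upd y j a).
Proof.
apply/andP/andP => -[/eqP <- /eqP ->]; rewrite upd_same upd_upd upd_id //.
Qed.

(* [unit_op j a b] is the matrix unit |a><b| acting on the j-th factor. *)
Definition unit_op j a b : E :=
  operator (fun x y => ((x j == a) && (y == upd x j b))%:R).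

Lemma entry_unit_opl j a b M x y :
  entry (unit_op j a b * M) x y = (x j == a)%:R * entry M (upd x j b) y.
Proof.
rewrite entryM (bigD1 (upd x j b)) //= big1 ?addr0 => [|z zx].
  by rewrite entry_operator eqxx andbT.
by rewrite entry_operator (negPf zx) andbF mul0r.
Qed.

Lemma entry_unit_opr j a b M x y :
  entry (M * unit_op j a b) x y = (y j == b)%:R * entry M x (upd y j a).
Proof.
rewrite entryM (bigD1 (upd y j a)) //= big1 ?addr0 => [|z zx].
  by rewrite entry_operator eq_upd eqxx andbT mulrC.
by rewrite entry_operator eq_upd (negPf zx) andbF mulr0.
Qed.

Lemma unit_opM j a b a' b' :
  unit_op j a b * unit_op j a' b' = (b == a')%:R *: unit_op j a b'.
Proof.
apply: entryP => x y.
rewrite entry_unit_opl entryZ !entry_operator upd_same upd_upd.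
by rewrite !natbM andbCA.
Qed.

Lemma unit_opC i j a b a' b' : i != j ->
  unit_op i a b * unit_op j a' b' = unit_op j a' b' * unit_op i a b.
Proof.
move=> ij; apply: entryP => x y.
have ji : j != i by rewrite eq_sym.
rewrite !entry_unit_opl !entry_operator (upd_other _ _ ij) (upd_other _ _ ji).
by rewrite !natbM upd_comm // andbCA.
Qed.

Lemma sum_unit_op j : \sum_a unit_op j a a = 1.
Proof.
apply: entryP => x y; rewrite entry_sum entry1 (bigD1 (x j)) //= big1.
  by rewrite entry_operator eqxx upd_id addr0 eq_sym.
by move=> a ax; rewrite entry_operator eq_sym (negPf ax).
Qed.

Lemma adjoint_unit_op j a b : adjoint (unit_op j a b) = unit_op j b a.
Proof.
apply: entryP => x y; rewrite entry_adjoint !entry_operator eq_upd.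
by rewrite rmorph_nat.
Qed.

Lemma unit_op_ketbra j a b u v :
  unit_op j a b * ketbra u v = (b == u j)%:R *: ketbra (upd u j a) v.
Proof.
apply: entryP => x y; rewrite entry_unit_opl entryZ !entry_ketbra !mulrA.
congr (_ * _); rewrite !natbM [upd x j b == u]eq_sym eq_upd.
by rewrite eq_sym.
Qed.

Lemma ketbra_unit_op j a b u v :
  ketbra u v * unit_op j a b = (v j == a)%:R *: ketbra u (upd v j b).
Proof.
apply: entryP => x y; rewrite entry_unit_opr entryZ !entry_ketbra.
rewrite mulrCA [RHS]mulrCA; congr (_ * _); rewrite !natbM.
by rewrite [upd y j a == v]eq_sym eq_upd.
Qed.

Definition permute x (s : {perm 'I_n}) : W := [ffun j => x (s j)].

Lemma permuteE x (s : {perm 'I_n}) j : permute x s j = x (s j).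
Proof. by rewrite ffunE. Qed.

Definition perm_op (s : {perm 'I_n}) : E :=
  operator (fun x y => (y == permute x s)%:R).

Lemma permuteK s x : permute (permute x s) s^-1%g = x.
Proof. by apply/ffunP => j; rewrite !ffunE permKV. Qed.

Lemma permuteKV s x : permute (permute x s^-1%g) s = x.
Proof. by apply/ffunP => j; rewrite !ffunE permK. Qed.

Lemma eq_permute s x y : (y == permute x s) = (x == permute y s^-1%g).
Proof. by apply/eqP/eqP => ->; rewrite ?permuteK ?permuteKV. Qed.

Lemma entry_perm_opl s M x y :
  entry (perm_op s * M) x y = entry M (permute x s) y.
Proof.
rewrite entryM (bigD1 (permute x s)) //= big1 ?addr0 => [|z zx].
  by rewrite entry_operator eqxx mul1r.
by rewrite entry_operator (negPf zx) mul0r.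
Qed.

Lemma perm_op1 : perm_op 1 = 1.
Proof.
apply: entryP => x y; rewrite entry_operator entry1 eq_sym; congr (_ == _)%:R.
by apply/ffunP => j; rewrite ffunE perm1.
Qed.

(** The product of permutations applies its left factor first, so [t * s] is the composite s after
    t, and [perm_op] is multiplicative for composition. *)
Lemma perm_opM s t : perm_op s * perm_op t = perm_op (t * s).
Proof.
apply: entryP => x y; rewrite entry_perm_opl !entry_operator; congr (_ == _)%:R.
by apply/ffunP => j; rewrite !ffunE permM.
Qed.

Lemma adjoint_perm_op s : adjoint (perm_op s) = perm_op s^-1%g.
Proof.
apply: entryP => x y; rewrite entry_adjoint !entry_operator eq_permute.
by rewrite rmorph_nat.
Qed.

Lemma perm_op_unit_op s j a b :
  perm_op s * unit_op j a b = unit_op (s j) a b * perm_op s.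
Proof.
apply: entryP => x y; rewrite entry_perm_opl entry_unit_opl !entry_operator.
rewrite natbM ffunE; congr ((_ && (_ == _))%:R).
by apply/ffunP => i; rewrite !ffunE (inj_eq perm_inj).
Qed.

(** Interpolates between 1, for empty [r], and [ketbra], for all columns; this allows an induction
    on the number of columns. *)
Definition unit_prod (r : seq 'I_n) u v : E := \prod_(j <- r) unit_op j (u j) (v j).

Lemma entry_unit_prod r u v x y : uniq r ->
  entry (unit_prod r u v) x y =
    ([forall j in r, x j == u j]
     && [forall j, y j == (if j \in r then v j else x j)])%:R.
Proof.
rewrite /unit_prod; elim: r x => [|i r IH] x /=.
  rewrite big_nil entry1 => _; congr ((_ : bool)%:R); rewrite eq_sym.
  transitivity [forall j, y j == x j]; first by apply/eqP/eqfunP => [->//|/ffunP].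
  by rewrite (_ : [forall j in [::], _]); last by apply/forall_inP.
move=> /andP[ir ur]; rewrite big_cons entry_unit_opl IH // natbM.
congr ((_ : bool)%:R); apply/idP/idP.
  case/and3P => /eqP xi /forall_inP h1 /forallP h2; apply/andP; split.
    apply/forall_inP => j; rewrite inE; case: eqP => [-> _|/eqP ji /= jr].
      by rewrite xi.
    by have := h1 j jr; rewrite upd_other.
  apply/forallP => j; rewrite (eqP (h2 j)) inE; case: (eqVneq j i) => [->|ji] /=.
    by rewrite (negPf ir) upd_same.
  by rewrite upd_other.
case/andP => /forall_inP h1 /forallP h2; apply/and3P; split.
- by apply: h1; rewrite inE eqxx.
- apply/forall_inP => j jr; rewrite upd_other.
    by apply: h1; rewrite inE jr orbT.
  by apply: contraNneq ir => <-.
apply/forallP => j; rewrite (eqP (h2 j)) inE; case: (eqVneq j i) => [->|ji] /=.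
  by rewrite (negPf ir) upd_same.
by rewrite upd_other.
Qed.

Lemma ketbra_unit_prod u v : ketbra u v = unit_prod (enum 'I_n) u v.
Proof.
apply: entryP => x y; rewrite entry_unit_prod ?enum_uniq // entry_ketbra natbM.
congr ((_ && _)%:R).
  apply/eqP/forall_inP => [-> j _ //|h]; apply/ffunP => j.
  by apply/eqP/h; rewrite mem_enum.
apply/eqP/forallP => [-> j|h]; first by rewrite mem_enum.
by apply/ffunP => j; move/eqP: (h j); rewrite mem_enum.
Qed.

Lemma unit_op_unit_prod j a b r u v : uniq r -> j \in r ->
  unit_op j a b * unit_prod r u v = (b == u j)%:R *: unit_prod r (upd u j a) v.
Proof.
rewrite /unit_prod; elim: r => // i r IH /= /andP[ir ur].
rewrite inE !big_cons; case: (eqVneq j i) => [-> _|ji /= jr].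
  rewrite mulrA unit_opM -scalerAl upd_same; congr (_ *: (_ * _)).
  apply: eq_big_seq => k kr; rewrite upd_other //.
  by apply: contraNneq ir => <-.
by rewrite mulrA unit_opC // -mulrA IH // -scalerAr upd_other // eq_sym.
Qed.

Lemma perm_op_unit_prod (s : {perm 'I_n}) (r : seq 'I_n) u v :
  {in r, forall j, s j = j} ->
  perm_op s * unit_prod r u v = unit_prod r u v * perm_op s.
Proof.
rewrite /unit_prod; elim: r => [|i r IH] sr; first by rewrite big_nil mulr1 mul1r.
rewrite big_cons mulrA perm_op_unit_op sr ?mem_head // -!mulrA IH // => j jr.
by apply: sr; rewrite inE jr orbT.
Qed.

End Columns.
End Operators.

Lemma conj_mul (A : pzRingType) (s t x x' z : A) :
  s * x = x' * s -> s * z = z * s -> s * t = 1 -> s * (x * z) * t = x' * z.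
Proof. by move=> sx sz st; rewrite mulrA sx -!mulrA (mulrA s) sz -mulrA st mulr1. Qed.

Section SpanProducts.
Variables (K : fieldType) (A : falgType K).

Lemma span_prodv_sub (X Y : seq A) (V : {vspace A}) :
  (forall u v, u \in X -> v \in Y -> u * v \in V) -> (<<X>> * <<Y>> <= V)%VS.
Proof.
move=> XY; apply/prodvP => u v uX vY.
suff /subvP/(_ u uX) : (<<X>> <= amulr v @^-1: V)%VS by rewrite -memv_preim lfunE.
apply/span_subvP => {uX}u uX; rewrite -memv_preim lfunE /=.
suff /subvP/(_ v vY) : (<<Y>> <= amull u @^-1: V)%VS by rewrite -memv_preim lfunE.
by apply/span_subvP => {vY}v vY; rewrite -memv_preim lfunE /= XY.
Qed.

End SpanProducts.

Lemma endo_bicommutant (R : realType) d n (X : seq (endo R d n)) (x : endo R d n) :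
  (forall u : endo R d n, u \in X -> adjoint u \in X) ->
  (forall t : endo R d n, (forall u, u \in X -> t * u = u * t) -> x * t = t * x) ->
  x \in agenv <<X>>%VS.
Proof. by move=> adX; exact: bicommutant. Qed.

(** * The first fundamental theorem for a set of columns *)

Section PermutationCommutant.
Variables (R : realType) (d : nat).
Hypothesis d_gt0 : (0 < d)%N.
Variables (n : nat) (U : {set 'I_n}).
Local Notation E := (endo R d n).
Local Notation e := (@unit_op R d n).
Local Notation P := (@perm_op R d n).

Definition symmetrize (z : E) : E := \sum_(s in Sym U) P s * z * P s^-1%g.

Lemma symmetrize_sum I (r : seq I) (Q : pred I) (F : I -> E) :
  symmetrize (\sum_(i <- r | Q i) F i) = \sum_(i <- r | Q i) symmetrize (F i).
Proof.
rewrite /symmetrize exchange_big; apply: eq_bigr => s _.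
by rewrite mulr_sumr mulr_suml.
Qed.

Lemma symmetrizeZ c z : symmetrize (c *: z) = c *: symmetrize z.
Proof.
rewrite /symmetrize scaler_sumr; apply: eq_bigr => s _.
by rewrite -scalerAr -scalerAl.
Qed.

Lemma symmetrizeMl x z : (forall s, s \in Sym U -> GRing.comm x (P s)) ->
  symmetrize (x * z) = x * symmetrize z.
Proof.
move=> xs; rewrite /symmetrize mulr_sumr; apply: eq_bigr => s sU.
by rewrite !mulrA xs.
Qed.

Lemma symmetrize_conj s z : s \in Sym U ->
  symmetrize (P s * z * P s^-1%g) = symmetrize z.
Proof.
move=> sU; rewrite /symmetrize [RHS](reindex_inj (mulgI s)) /=.
apply: eq_big => [t|t _]; first by rewrite groupMl.
by rewrite invMg -!perm_opM // !mulrA.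
Qed.

(** The diagonal action of the matrix unit E_ab of gl_d on the tensor factors in [U]. *)
Definition site_sum a b : E := \sum_(j in U) e j a b.

Lemma site_sum_perm_op a b s : s \in Sym U -> GRing.comm (site_sum a b) (P s).
Proof.
rewrite inE => sU; rewrite /GRing.comm /site_sum mulr_sumr mulr_suml.
rewrite (reindex_inj (@perm_inj _ s)) /=.
apply: eq_big => [j|j _]; first by rewrite perm_closed.
by rewrite perm_op_unit_op.
Qed.

(* First fundamental theorem for gl_d, with matrix algebras acting on the
   columns outside U. Symmetrized products of matrix units commute with T by
   induction on the number of factors: multiplying such a product by site_sum
   adds a factor at a new column, up to products with the same factors. *)
Lemma comm_sum_perm_op (T : E) :
  (forall a b, site_sum a b \in 'C[T]%VS) ->
  (forall j a b, j \notin U -> e j a b \in 'C[T]%VS) ->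
  T \in <<[seq P s | s in Sym U]>>%VS.
Proof.
move=> TU TUc; set X := [seq P s | s in Sym U].
have XP s : s \in Sym U -> P s \in X by move=> sU; apply: image_f.
have memX u : u \in X -> exists2 s, s \in Sym U & u = P s by move/imageP.
suff: T \in agenv <<X>>.
  apply/subvP/agenv_sub_modl.
    by rewrite -memvE -(perm_op1 R d_gt0); apply/memv_span/XP/group1.
  apply: span_prodv_sub => _ _ /memX[s sU ->] /memX[t tU ->].
  by rewrite perm_opM //; apply/memv_span/XP; rewrite groupM.
apply: endo_bicommutant => [_ /memX[s sU ->]|t tX].
  by rewrite adjoint_perm_op //; apply: XP; rewrite groupV.
have natC (m : nat) (x : E) : (0 < m)%N -> x *+ m \in 'C[T]%VS -> x \in 'C[T]%VS.
  move=> m0 xm; have m1 : (m%:R : R[i]) != 0 by rewrite pnatr_eq0 -lt0n.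
  by rewrite -[x]scale1r -(mulVf m1) -scalerA scaler_nat rpredZ.
apply/esym/cent1vP.
have symC r u v : uniq r -> symmetrize (unit_prod R r u v) \in 'C[T]%VS.
  elim: r u v => [|j r IH] u v.
    rewrite /unit_prod big_nil => _; apply: rpred_sum => s _.
    by rewrite mulr1 perm_opM // mulVg perm_op1 // cent1v1.
  move=> /= /andP[jr ur]; rewrite /unit_prod big_cons -/(unit_prod R r u v).
  have [jU|jU] := boolP (j \in U); last first.
    rewrite symmetrizeMl ?memvM ?TUc ?IH // => s.
    by rewrite inE => sU; rewrite /GRing.comm perm_op_unit_op // (out_perm sU).
  set a := u j; set b := v j.
  have : symmetrize (site_sum a b * unit_prod R r u v) \in 'C[T]%VS.
    by rewrite symmetrizeMl ?memvM ?TU ?IH // => s sU; exact: site_sum_perm_op.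
  rewrite /site_sum mulr_suml symmetrize_sum (bigID (mem r)) /=.
  rewrite rpredDl; last first.
    apply: rpred_sum => l /andP[_ lr].
    by rewrite unit_op_unit_prod // symmetrizeZ rpredZ // IH.
  (* All new columns [l] give the same term, since the transposition of [l] and [j] lies in [Sym U]
     and fixes [r]. Their number is positive, [j] being one of them, and can be divided out. *)
  rewrite (eq_bigr (fun=> symmetrize (e j a b * unit_prod R r u v))).
    rewrite sumr_const; apply: natC; apply/card_gt0P; exists j.
    by apply/andP.
  move=> l /andP[lU lr]; rewrite -(@symmetrize_conj (tperm l j)); last first.
    rewrite inE; apply/subsetP => k; rewrite inE.
    by case: tpermP => [->|->|]; rewrite ?eqxx.
  rewrite (conj_mul (perm_op_unit_op R d_gt0 _ _ _ _)
    (perm_op_unit_prod R d_gt0 _ _ _)).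
  - by rewrite tpermL.
  - move=> k kr; rewrite tpermD //; first by apply: contraNneq lr => ->.
    by apply: contraNneq jr => ->.
  - by rewrite perm_opM // mulVg perm_op1.
(* An operator commuting with the permutations is a multiple of its own symmetrization, so only
   symmetrized matrix units remain to be treated. *)
apply: (natC #|Sym U|); first by rewrite cardG_gt0.
have -> : t *+ #|Sym U| = symmetrize t.
  rewrite -sumr_const; apply: eq_bigr => s sU.
  by rewrite -(tX _ (XP s sU)) -mulrA perm_opM // mulVg perm_op1 // mulr1.
rewrite [t](operator_entry d_gt0) symmetrize_sum rpred_sum // => u _.
rewrite symmetrize_sum rpred_sum // => v _.
by rewrite symmetrizeZ rpredZ // ketbra_unit_prod // symC // enum_uniq.
Qed.

End PermutationCommutant.

(** * Commutators and the filtration by word length *)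

Section Bracket.
Variables (K : fieldType) (A : falgType K).
Implicit Types (t x y : A).

Definition bracket t x := t * x - x * t.

Lemma bracket_linear t : linear (bracket t).
Proof.
move=> c x y; rewrite /bracket mulrDr mulrDl -scalerAr -scalerAl scalerBr opprD.
by rewrite addrACA.
Qed.

HB.instance Definition _ t :=
  GRing.isLinear.Build K A A _ (bracket t) (bracket_linear t).

Lemma bracketM t x y : bracket t (x * y) = bracket t x * y + x * bracket t y.
Proof. by rewrite /bracket mulrBl mulrBr !mulrA addrA subrK. Qed.

Lemma bracket_eq0 t x : (bracket t x == 0) = (t * x == x * t).
Proof. by rewrite subr_eq0. Qed.

Lemma bracket_prod (I : eqType) (r : seq I) (g : I -> A) t : uniq r ->
  bracket t (\prod_(i <- r) g i) =
  \sum_(i <- r) \prod_(j <- r) (if j == i then bracket t (g i) else g j).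
Proof.
elim: r => [|k r IH] /=; first by rewrite !big_nil /bracket mulr1 mul1r subrr.
case/andP => kr ur; rewrite !big_cons eqxx bracketM IH // mulr_sumr.
congr (_ * _ + _).
  by apply: eq_big_seq => j jr; case: eqP kr => // <-; rewrite jr.
apply: eq_big_seq => i ir; rewrite big_cons; case: eqP kr => // ->.
by rewrite ir.
Qed.

(** [L] and [M] do not depend on [x]: the product is linear in the replaced factor, so each term of
    the Leibniz rule can be expanded. *)
Lemma prod_replace (I : eqType) (r : seq I) (g : I -> A) i :
  uniq r -> i \in r ->
  exists L M, forall x, \prod_(j <- r) (if j == i then x else g j) = L * x * M.
Proof.
elim: r => // k r IH /= /andP[kr ur]; rewrite inE.
case: (eqVneq i k) => [-> _|ik /= /(IH ur)[L [M LM]]].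
  exists 1, (\prod_(j <- r) g j) => x; rewrite big_cons eqxx mul1r.
  congr (_ * _); apply: eq_big_seq => j jr.
  by case: eqP kr => // <-; rewrite jr.
exists (g k * L), M => x; rewrite big_cons LM [k == i]eq_sym (negPf ik).
by rewrite !mulrA.
Qed.

Lemma bracket_expv (U : {vspace A}) t s x :
  (forall y, y \in U -> bracket t y \in U) -> x \in (U ^+ s)%VS ->
  bracket t x \in (U ^+ s)%VS.
Proof.
move=> tU; suff /subvP h : (U ^+ s <= linfun (bracket t) @^-1: (U ^+ s))%VS.
  by move/h; rewrite -memv_preim lfunE.
elim: s => [|s IH].
  apply/subvP => y; rewrite expv0 -memv_preim lfunE /= => /vlineP[c ->].
  by rewrite /bracket -scalerAl -scalerAr mulr1 mul1r subrr mem0v.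
rewrite {1}expvSl; apply/prodvP => u v uU vU.
rewrite -memv_preim lfunE /= bracketM expvSl rpredD // memv_mul ?tU //.
by move/subvP/(_ v vU): IH; rewrite -memv_preim lfunE.
Qed.

Lemma prod_expv (I : Type) (r : seq I) (Q : pred I) (g : I -> A) (U : {vspace A}) :
  (forall i, Q i -> g i \in U) ->
  \prod_(i <- r | Q i) g i \in (U ^+ count Q r)%VS.
Proof.
move=> gU; elim: r => [|i r IH] /=; first by rewrite big_nil memv_line.
rewrite big_cons; case: ifP => Qi; rewrite ?add0n // add1n expvSl.
by rewrite memv_mul ?gU.
Qed.

(** The filtration in which, once [U] is closed under brackets, letters commute modulo shorter
    words, as in the Poincare-Birkhoff-Witt theorem. *)
Definition expv_lt (U : {vspace A}) r := (\sum_(s < r) U ^+ s)%VS.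

Lemma expv_ltS U r : expv_lt U r.+1 = (expv_lt U r + U ^+ r)%VS.
Proof. by rewrite /expv_lt big_ord_recr. Qed.

Lemma sub_expv_lt U r s : (s < r)%N -> (U ^+ s <= expv_lt U r)%VS.
Proof. by move=> sr; apply: (sumv_sup (Ordinal sr)). Qed.

Lemma mul_expv_lt U r : (U * expv_lt U r <= expv_lt U r.+1)%VS.
Proof.
rewrite /expv_lt big_distrr /=; apply/subv_sumP => s _; rewrite -expvSl.
by apply: (@sub_expv_lt U r.+1 s.+1); rewrite ltnS.
Qed.

(** Passing a letter through another one costs their bracket, which is again a single letter, so the
    correction is a shorter word. *)
Lemma move_factor (I : eqType) (r : seq I) (g : I -> A) (U : {vspace A}) j :
  (forall t y, t \in U -> y \in U -> bracket t y \in U) ->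
  (forall i, g i \in U) -> uniq r -> j \in r ->
  \prod_(i <- r) g i - (\prod_(i <- r | i != j) g i) * g j
    \in expv_lt U (size r).
Proof.
move=> UU gU; elim: r => // i r IH /= /andP[ir ur]; rewrite inE.
rewrite !big_cons; case: (eqVneq j i) ir => [<- jr _|ij ir /= jr].
  have -> : \prod_(k <- r | k != j) g k = \prod_(k <- r) g k.
    rewrite big_seq_cond [RHS]big_seq; apply: eq_bigl => k.
    by case: eqP => [->|]; rewrite ?andbT ?(negPf jr).
  apply: (subvP (sub_expv_lt U (ltnSn _))).
  rewrite -(count_predT r) -/(bracket _ _) bracket_expv ?prod_expv //.
  by move=> y; apply: UU.
rewrite -mulrA -mulrBr; apply: (subvP (mul_expv_lt U _)).
by rewrite memv_mul ?gU ?IH.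
Qed.

End Bracket.

(** * Substituting letters of an algebra for matrix units *)

Section TensorMap.
Variables (R : realType) (d : nat).
Hypothesis d_gt0 : (0 < d)%N.
Local Notation C := R[i].
Variable A : falgType C.
Implicit Type f : 'I_d -> 'I_d -> A.

Section Family.
Variables (m : nat) (f : 'I_m -> 'I_d -> 'I_d -> A).

Definition monomial (u v : word d m) : A := \prod_(i < m) f i (u i) (v i).

(** This substitution is not multiplicative in general; what it preserves is the action of gl_d, see
    [tensor_map_bracket]. *)
Definition tensor_map (M : endo R d m) : A :=
  \sum_u \sum_v entry M u v *: monomial u v.

Lemma tensor_map_linear : linear tensor_map.
Proof.
move=> c M N; rewrite /tensor_map scaler_sumr -big_split; apply: eq_bigr => u _.
rewrite scaler_sumr -big_split; apply: eq_bigr => v _.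
by rewrite entryD entryZ scalerDl scalerA.
Qed.

HB.instance Definition _ :=
  GRing.isLinear.Build C (endo R d m) A _ tensor_map tensor_map_linear.

Lemma tensor_map_ketbra u v : tensor_map (ketbra R u v) = monomial u v.
Proof.
rewrite /tensor_map (bigD1 u) //= [X in _ + X]big1 ?addr0 => [|x xu].
  rewrite (bigD1 v) //= big1 ?addr0 => [|y yv].
    by rewrite entry_ketbra // !eqxx mulr1 scale1r.
  by rewrite entry_ketbra // (negPf yv) mulr0 scale0r.
by apply: big1 => y _; rewrite entry_ketbra // (negPf xu) mul0r scale0r.
Qed.

Lemma tensor_map_perm_op s :
  tensor_map (perm_op R d s) = \sum_x monomial x (permute x s).
Proof.
apply: eq_bigr => x _; rewrite (bigD1 (permute x s)) //= big1 ?addr0 => [|y yx].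
  by rewrite entry_operator // eqxx scale1r.
by rewrite entry_operator // (negPf yx) scale0r.
Qed.

End Family.

Variable T : 'I_d -> 'I_d -> A.

(** The commutation rule of E_ab with E_xy in gl_d, with [T] acting and [f] acted upon; for [f = T]
    it says that [T] is a representation. *)
Definition equivariant f := forall a b x y,
  bracket (T a b) (f x y) = (b == x)%:R *: f a y - (a == y)%:R *: f x b.

Definition total_op m a b : endo R d m := \sum_i unit_op R i a b.

Lemma adjoint_total_op m a b : adjoint (total_op m a b) = total_op m b a.
Proof.
by rewrite /total_op adjoint_sum; apply: eq_bigr => i _; rewrite adjoint_unit_op.
Qed.

Lemma bracket_monomial m (f : 'I_m -> 'I_d -> 'I_d -> A) a b u v :
  (forall i, equivariant (f i)) ->
  bracket (T a b) (monomial f u v) =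
  \sum_i ((b == u i)%:R *: monomial f (upd u i a) v
          - (v i == a)%:R *: monomial f u (upd v i b)).
Proof.
move=> fT; rewrite /monomial bracket_prod ?index_enum_uniq //.
apply: eq_bigr => i _; rewrite fT.
have [L [M LM]] := prod_replace (fun j => f j (u j) (v j))
  (index_enum_uniq 'I_m) (mem_index_enum i).
rewrite LM mulrBr mulrBl -!scalerAr -!scalerAl -!LM [v i == a]eq_sym.
by congr (_ *: _ - _ *: _); apply: eq_bigr => j _;
  case: (eqVneq j i) => [->|ji]; rewrite ?upd_same ?upd_other.
Qed.

Lemma tensor_map_bracket m (f : 'I_m -> 'I_d -> 'I_d -> A) a b M :
  (forall i, equivariant (f i)) ->
  bracket (T a b) (tensor_map f M) = tensor_map f (bracket (total_op m a b) M).
Proof.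
move=> fT; rewrite [M in RHS](operator_entry d_gt0) /tensor_map linear_sum.
rewrite -/(tensor_map f _) [in RHS]linear_sum /= [RHS]linear_sum /=.
apply: eq_bigr => u _; rewrite linear_sum [in RHS]linear_sum /= [RHS]linear_sum /=.
apply: eq_bigr => v _; rewrite linearZ [in RHS]linearZ /= [RHS]linearZ /=.
congr (_ *: _); rewrite bracket_monomial // /bracket /total_op.
rewrite mulr_suml mulr_sumr -sumrB linear_sum /=; apply: eq_bigr => i _.
rewrite unit_op_ketbra // ketbra_unit_op // linearB /= !linearZ /=.
by rewrite !tensor_map_ketbra.
Qed.

End TensorMap.

(** Exchanging [a] with [x j] is an involution on the pairs (x, a). Inverting this factor [d] is
    what puts [d%:R^-1] into [tensor_map_fixed] and [tensor_map_linked]. *)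
Lemma sum_upd (V : zmodType) d n (j : 'I_n) (F : word d n -> V) :
  \sum_x \sum_a F (upd x j a) = (\sum_x F x) *+ d.
Proof.
rewrite pair_bigA /= (reindex (fun p : word d n * 'I_d => (upd p.1 j p.2, p.1 j))) /=.
  rewrite -(pair_bigA _ (fun x a => F (upd (upd x j a) j (x j)))) /=.
  under eq_bigr => x _ do under eq_bigr => a _ do rewrite upd_upd upd_id.
  by rewrite -sumrMnl; apply: eq_bigr => x _; rewrite sumr_const card_ord.
exists (fun p => (upd p.1 j p.2, p.1 j)) => -[x a] _ /=;
  by rewrite upd_upd upd_id upd_same.
Qed.

(** * Invariant words in D and e: splitting off the split Casimir element [omega] *)

Section Peel.
Variables (R : realType) (d : nat).
Hypothesis d_gt0 : (0 < d)%N.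
Local Notation C := R[i].
Variables (A : falgType C) (D e : 'I_d -> 'I_d -> A).
Local Notation T := (fun a b => D a b + e a b).
Hypothesis bracketDD : equivariant D D.
Hypothesis bracketDe : forall a b x y, bracket (D a b) (e x y) = 0.
Hypothesis mul_e : forall a b x y, e a b * e x y = (b == x)%:R *: e a y.
Hypothesis sum_e : \sum_a e a a = 1.

Definition omega := \sum_a \sum_b D a b * e b a.

(** Substituting it for a letter amounts to a trace over that tensor factor: a slot is erased
    without losing equivariance. *)
Definition scalar_family (x y : 'I_d) : A := (x == y)%:R *: 1.

Lemma bracketDl (s t x : A) : bracket (s + t) x = bracket s x + bracket t x.
Proof. by rewrite /bracket mulrDl mulrDr opprD addrACA. Qed.

Lemma bracketC (s t : A) : bracket s t = - bracket t s.
Proof. by rewrite /bracket opprB. Qed.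

Lemma equivariant_D : equivariant T D.
Proof.
move=> a b x y; rewrite bracketDl bracketDD [X in _ + X]bracketC bracketDe.
by rewrite oppr0 addr0.
Qed.

Lemma equivariant_e : equivariant T e.
Proof.
move=> a b x y; rewrite bracketDl bracketDe add0r /bracket !mul_e.
by rewrite [y == a]eq_sym.
Qed.

Lemma equivariant_scalar : equivariant T scalar_family.
Proof.
move=> a b x y; rewrite /bracket /scalar_family -scalerAl -scalerAr mulr1 mul1r.
by rewrite subrr !scalerA [b == x]eq_sym mulrC subrr.
Qed.

Lemma comm_omega a b : bracket (T a b) omega = 0.
Proof.
rewrite /omega linear_sum /=.
have -> : \sum_x bracket (D a b + e a b) (\sum_y D x y * e y x) =
  \sum_x \sum_y (((b == x)%:R *: D a y - (a == y)%:R *: D x b) * e y x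
    + D x y * ((b == y)%:R *: e a x - (a == x)%:R *: e y b)).
  apply: eq_bigr => x _; rewrite linear_sum /=; apply: eq_bigr => y _.
  by rewrite bracketM equivariant_D equivariant_e.
have delta (F : 'I_d -> A) c : \sum_x (c == x)%:R *: F x = F c.
  rewrite (bigD1 c) //= big1 ?addr0 => [|x xc]; first by rewrite eqxx scale1r.
  by rewrite eq_sym (negPf xc) scale0r.
(* In this grouping the last two terms cancel after summing over [y], the first two after summing
   over [x] as well. *)
have split x y : ((b == x)%:R *: D a y - (a == y)%:R *: D x b) * e y x
    + D x y * ((b == y)%:R *: e a x - (a == x)%:R *: e y b) =
  ((b == x)%:R *: (D a y * e y x) - (a == x)%:R *: (D x y * e y b))
  + ((b == y)%:R *: (D x y * e a x) - (a == y)%:R *: (D x b * e y x)).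
  by rewrite mulrBl mulrBr -!scalerAl -!scalerAr addrACA [- _ - _]addrC addrACA.
under eq_bigr => x _ do under eq_bigr => y _ do rewrite split.
under eq_bigr => x _ do
  rewrite big_split /= !sumrB !delta -!scaler_sumr subrr addr0.
by rewrite sumrB !delta subrr.
Qed.

Lemma e_omega u v : e u v * omega = \sum_a D a v * e u a.
Proof.
rewrite /omega mulr_sumr; apply: eq_bigr => a _; rewrite mulr_sumr.
rewrite (bigD1 v) //= big1 ?addr0 => [|b bv].
  have /eqP := bracketDe a v u v; rewrite bracket_eq0 => /eqP h.
  by rewrite mulrA -h -mulrA mul_e eqxx scale1r.
have /eqP := bracketDe a b u v; rewrite bracket_eq0 => /eqP h.
by rewrite mulrA -h -mulrA mul_e eq_sym (negPf bv) scale0r mulr0.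
Qed.

Definition Dspan := <<[seq D p.1 p.2 | p : 'I_d * 'I_d]>>%VS.
Definition espan := <<[seq e p.1 p.2 | p : 'I_d * 'I_d]>>%VS.

Lemma mem_Dspan a b : D a b \in Dspan.
Proof. by apply: memv_span; apply/imageP; exists (a, b). Qed.

Lemma mem_espan a b : e a b \in espan.
Proof. by apply: memv_span; apply/imageP; exists (a, b). Qed.

Lemma bracket_Dspan t y : t \in Dspan -> y \in Dspan -> bracket t y \in Dspan.
Proof.
move=> tD yD.
suff /subvP/(_ y yD) : (Dspan <= linfun (bracket t) @^-1: Dspan)%VS.
  by rewrite -memv_preim lfunE.
apply/span_subvP => _ /imageP[[a b] _ ->]; rewrite -memv_preim lfunE /=.
rewrite bracketC rpredN.
suff /subvP/(_ t tD) : (Dspan <= linfun (bracket (D a b)) @^-1: Dspan)%VS.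
  by rewrite -memv_preim lfunE.
apply/span_subvP => _ /imageP[[x y'] _ ->]; rewrite -memv_preim lfunE /=.
by rewrite bracketDD rpredB ?rpredZ ?mem_Dspan.
Qed.

Lemma agenv_Dspan_comm_e z a b : z \in agenv Dspan -> bracket (e a b) z = 0.
Proof.
move=> zD; suff /subvP/(_ z zD) : (agenv Dspan <= 'C[e a b])%VS.
  by move/cent1vP => h; apply/eqP; rewrite bracket_eq0 h.
apply: agenv_sub_modl; first by rewrite -memvE cent1v1.
apply/prodvP => u v uD vC; apply: memvM => //.
suff /subvP/(_ u uD) : (Dspan <= 'C[e a b])%VS by [].
apply/span_subvP => _ /imageP[[x y] _ ->]; apply/cent1vP/eqP.
by rewrite -bracket_eq0 bracketDe.
Qed.

(* Products of r letters D followed by one letter e; [level r] collects the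
   products with fewer than r letters D. *)
Definition slots r (i : 'I_r.+1) := if (i < r)%N then D else e.
Definition layer r := (Dspan ^+ r * espan)%VS.
Definition level r := (expv_lt Dspan r * espan)%VS.

Lemma levelS r : level r.+1 = (level r + layer r)%VS.
Proof. by rewrite /level expv_ltS prodvDl. Qed.

Lemma slots_equivariant r i : equivariant T (@slots r i).
Proof.
by rewrite /slots; case: ifP => _; [exact: equivariant_D | exact: equivariant_e].
Qed.

Lemma monomial_slots r u v : monomial (@slots r) u v =
  (\prod_(i < r) D (u (widen_ord (leqnSn r) i)) (v (widen_ord (leqnSn r) i)))
  * e (u ord_max) (v ord_max).
Proof.
rewrite /monomial big_ord_recr /= /slots ltnn; congr (_ * _).
by apply: eq_bigr => i _; rewrite /= ltn_ord.
Qed.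

Lemma tensor_map_slots r M : tensor_map (@slots r) M \in layer r.
Proof.
rewrite rpred_sum // => u _; rewrite rpred_sum // => v _; rewrite rpredZ //.
rewrite monomial_slots memv_mul ?mem_espan //.
have := prod_expv (index_enum 'I_r) (Q := xpredT) (U := Dspan)
  (g := fun i => D (u (widen_ord (leqnSn r) i)) (v (widen_ord (leqnSn r) i)))
  (fun i _ => mem_Dspan _ _).
by rewrite count_predT -[size _]/(size (Finite.enum 'I_r)) -enumT size_enum_ord.
Qed.

Lemma layer_tensor_map r x : x \in layer r -> exists M, x = tensor_map (@slots r) M.
Proof.
suff /subvP h : (layer r <= limg (linfun (tensor_map (@slots r))))%VS.
  by move/h/memv_imgP => [M _ ->]; exists M; rewrite lfunE.
rewrite /layer; elim: r {x} => [|r IH].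
  rewrite expv0 prod1v; apply/span_subvP => _ /imageP[[a b] _ ->] /=.
  apply/memv_imgP; exists (ketbra R [ffun=> a] [ffun=> b]); rewrite ?memvf //.
  by rewrite lfunE /= tensor_map_ketbra // monomial_slots big_ord0 mul1r !ffunE.
rewrite expvSl -prodvA; apply/prodvP => t y tD /(subvP IH)/memv_imgP[M _ ->].
rewrite lfunE /=; set V := limg _.
suff /subvP/(_ t tD) : (Dspan <= amulr (tensor_map (@slots r) M) @^-1: V)%VS.
  by rewrite -memv_preim lfunE.
apply/span_subvP => _ /imageP[[a b] _ ->]; rewrite -memv_preim lfunE /=.
rewrite mulr_sumr rpred_sum // => u _; rewrite mulr_sumr rpred_sum // => v _.
rewrite -scalerAr rpredZ //.
pose cons (c : 'I_d) (w : word d r.+1) : word d r.+2 :=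
  [ffun i => if unlift ord0 i is Some j then w j else c].
have cons0 c w : cons c w ord0 = c by rewrite ffunE unlift_none.
have consS c w i : cons c w (lift ord0 i) = w i by rewrite ffunE liftK.
apply/memv_imgP; exists (ketbra R (cons a u) (cons b v)); rewrite ?memvf //.
rewrite lfunE /= tensor_map_ketbra // /monomial [RHS]big_ord_recl !cons0.
by congr (_ * _); apply: eq_bigr => i _; rewrite !consS.
Qed.

Lemma bracket_level r a b x : x \in level r -> bracket (T a b) x \in level r.
Proof.
elim: r x => [|r IH] x; first by rewrite /level /expv_lt big_ord0 prod0v
  => /vlineP[c ->]; rewrite scaler0 linear0 mem0v.
rewrite levelS => /memv_addP[l lr [_ /layer_tensor_map[M ->] ->]].
rewrite linearD /= memv_add ?IH //.
by rewrite (tensor_map_bracket d_gt0 _ _ _ (@slots_equivariant r)) tensor_map_slots.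
Qed.

(* An invariant element lifts to an invariant tensor modulo lower levels: the
   preimage of [level r] is stable under brackets, hence so is its orthogonal
   complement, on which tensor_map is injective modulo [level r]. *)
Lemma lift_invariant r x :
  x \in level r.+1 -> (forall a b, bracket (T a b) x = 0) ->
  exists M l, [/\ x = tensor_map (@slots r) M + l, l \in level r &
    forall a b, bracket (total_op R r.+1 a b) M = 0].
Proof.
rewrite levelS => /memv_addP[l0 l0r [_ /layer_tensor_map[M0 ->] ->]] xT.
pose K := (linfun (tensor_map (@slots r)) @^-1: level r)%VS.
have KE M : (M \in K) = (tensor_map (@slots r) M \in level r).
  by rewrite -memv_preim lfunE.
have [K0 [K1 [M0E K0K oK]]] := orthogonal_decomposition K M0.
rewrite {}M0E in xT *.
rewrite KE in K0K.
have tb a b M : bracket (D a b + e a b) (tensor_map (@slots r) M) =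
    tensor_map (@slots r) (bracket (total_op R r.+1 a b) M).
  exact: (tensor_map_bracket d_gt0 _ _ _ (@slots_equivariant r)).
exists K1, (l0 + tensor_map (@slots r) K0); split.
- by rewrite linearD /= addrA addrC.
- by rewrite rpredD.
(* The bracket of [K1] lies in [K] because [x] is invariant, and it is orthogonal to [K]; hence it
   vanishes. *)
move=> a b; apply: hs_eq0.
have bK : bracket (total_op R r.+1 a b) K1 \in K.
  rewrite KE -tb; have := xT a b.
  rewrite [tensor_map _ _]linearD addrA linearD /= => /eqP.
  rewrite addr_eq0 => /eqP h; rewrite -rpredN -h.
  by apply: bracket_level; rewrite rpredD.
have hsBl (u v w : endo R d r.+1) : hs (u - v) w = hs u w - hs v w.
  by rewrite hsC hsBr rmorphB /= -!hsC.
have hs_bracket (z : endo R d r.+1) :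
    hs z (bracket (total_op R r.+1 a b) K1) = hs (bracket (total_op R r.+1 b a) z) K1.
  by rewrite /bracket hsBl hsMl hsMr (adjoint_total_op R d_gt0) -hsBr.
rewrite hs_bracket.
by apply: oK; rewrite KE -tb; apply: bracket_level; rewrite -KE.
Qed.

Local Notation low := (widen_ord (leqnSn _)).

Lemma low_neq_max r (i : 'I_r) : low i != ord_max.
Proof. by rewrite -val_eqE /= ltn_eqF. Qed.

Lemma slots_low r (i : 'I_r) : slots (low i) = D.
Proof. by rewrite /slots /= ltn_ord. Qed.

Lemma slots_max r : slots (ord_max : 'I_r.+1) = e.
Proof. by rewrite /slots ltnn. Qed.

Lemma size_index_ord r : size (index_enum 'I_r) = r.
Proof. by rewrite -[size _]/(size (Finite.enum 'I_r)) -enumT size_enum_ord. Qed.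

Definition fill r (j : 'I_r.+1) (i : 'I_r.+1) :=
  if i == j then scalar_family else slots i.

Lemma fill_equivariant r j i : equivariant T (@fill r j i).
Proof.
rewrite /fill; case: eqP => _; first exact: equivariant_scalar.
exact: slots_equivariant.
Qed.

Lemma bracket_total_perm_op m (s : {perm 'I_m}) a b :
  bracket (total_op R m a b) (perm_op R d s) = 0.
Proof.
apply/eqP; rewrite bracket_eq0; apply/eqP.
have -> : total_op R m a b = site_sum R [set: 'I_m] a b.
  by apply: eq_bigl => i; rewrite inE.
by apply: site_sum_perm_op => //; rewrite inE; apply/subsetP => i; rewrite !inE.
Qed.

Lemma tensor_map_perm_invariant m (f : 'I_m -> 'I_d -> 'I_d -> A) s a b :
  (forall i, equivariant T (f i)) ->
  bracket (D a b + e a b) (tensor_map f (perm_op R d s)) = 0.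
Proof.
move=> fT; have -> := tensor_map_bracket d_gt0 a b (perm_op R d s) fT.
by rewrite bracket_total_perm_op linear0.
Qed.

Lemma natf_d_neq0 : d%:R != 0 :> C.
Proof. by rewrite pnatr_eq0 -lt0n. Qed.

(** The last slot carries [e a a] with an index [a] that occurs nowhere else; summing over it gives
    1 and leaves a word in [D]. *)
Lemma tensor_map_fixed r (s : {perm 'I_r.+1}) : s ord_max = ord_max ->
  tensor_map (@slots r) (perm_op R d s) \in agenv Dspan.
Proof.
move=> smax; set x := tensor_map _ _.
suff : x *+ d \in agenv Dspan.
  rewrite -scaler_nat => /(rpredZ d%:R^-1).
  by rewrite scalerA mulVf ?natf_d_neq0 // scale1r.
rewrite /x tensor_map_perm_op // -(sum_upd ord_max) rpred_sum // => w _.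
have sl i : s (low i) != ord_max.
  by rewrite -smax (inj_eq perm_inj) low_neq_max.
rewrite (eq_bigr (fun a => (\prod_(i < r) D (w (low i)) (w (s (low i)))) * e a a)).
  rewrite -mulr_sumr sum_e mulr1.
  apply: (subvP (subX_agenv _ (count xpredT (index_enum 'I_r)))).
  by apply: prod_expv => i _; exact: mem_Dspan.
move=> a _; rewrite monomial_slots permuteE smax !upd_same; congr (_ * _).
by apply: eq_bigr => i _; rewrite permuteE !upd_other ?low_neq_max.
Qed.

(** The transposition acts first, so the product fixes [low j], whose erased slot contributes 1, and
    sends [ord_max] to [s (low j)]: the point [low j] is cut out of its cycle. *)
Lemma monomial_fill r (j : 'I_r) (s : {perm 'I_r.+1}) x : s ord_max = low j ->
  monomial (@fill r (low j)) x (permute x (tperm (low j) ord_max * s)) =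
  (\prod_(i < r | i != j) D (x (low i)) (x (s (low i))))
  * e (x ord_max) (x (s (low j))).
Proof.
move=> smax; rewrite /monomial big_ord_recr /=; congr (_ * _).
  rewrite [RHS]big_mkcond; apply: eq_bigr => i _; rewrite permuteE permM /fill.
  rewrite -[low i == _]val_eqE /= val_eqE slots_low.
  case: (eqVneq i j) => [->|ij] /=.
    by rewrite tpermL smax /scalar_family eqxx scale1r.
  by rewrite tpermD // eq_sym ?low_neq_max // -val_eqE /= val_eqE eq_sym.
by rewrite /fill eq_sym (negPf (low_neq_max j)) slots_max permuteE permM tpermR.
Qed.

Lemma tensor_map_fill r (j : 'I_r) (s : {perm 'I_r.+1}) : s ord_max = low j ->
  tensor_map (@fill r (low j)) (perm_op R d (tperm (low j) ord_max * s))
    \in level r.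
Proof.
move=> smax; rewrite tensor_map_perm_op // rpred_sum // => x _.
rewrite monomial_fill // memv_mul ?mem_espan //.
have lt : (count (fun i => i != j) (index_enum 'I_r) < r)%N.
  rewrite -[X in (_ < X)%N]size_index_ord ltn_neqAle count_size andbT -all_count.
  by apply/allPn; exists j; rewrite ?mem_index_enum // negbK.
apply: (subvP (sub_expv_lt _ lt)).
by apply: prod_expv => i _; exact: mem_Dspan.
Qed.

(* Modulo lower levels the letter D linked to e may be moved next to e, and
   summing over the index they share produces omega. *)
Lemma tensor_map_linked r (j : 'I_r) (s : {perm 'I_r.+1}) : s ord_max = low j ->
  tensor_map (@slots r) (perm_op R d s)
  - d%:R^-1 *: (tensor_map (@fill r (low j))
      (perm_op R d (tperm (low j) ord_max * s)) * omega) \in level r.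
Proof.
move=> smax; rewrite !tensor_map_perm_op //.
pose g (x : word d r.+1) (i : 'I_r) := D (x (low i)) (x (s (low i))).
pose K (x : word d r.+1) :=
  (\prod_(i < r | i != j) g x i) * g x j * e (x ord_max) (x (low j)).
(* The words in this sum do not involve [x (low j)]. The idle coordinate can serve as the index [a]
   summed in [e_omega], at the price of a factor [d]. *)
have -> : d%:R^-1 *: ((\sum_x monomial (@fill r (low j)) x
    (permute x (tperm (low j) ord_max * s))) * omega) = \sum_x K x.
  have dK (y : A) : y = d%:R^-1 *: (y *+ d).
    by rewrite -[y *+ d]scaler_nat scalerA mulVf ?natf_d_neq0 // scale1r.
  rewrite [RHS]dK -(sum_upd (low j)) mulr_suml; congr (_ *: _).
  apply: eq_bigr => x _.
  rewrite monomial_fill // -mulrA e_omega mulr_sumr; apply: eq_bigr => a _.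
  have sj i : s (low i) != low j.
    by rewrite -smax (inj_eq perm_inj) low_neq_max.
  rewrite /K /g upd_same !upd_other ?sj // 1?eq_sym ?low_neq_max //.
  rewrite mulrA; congr (_ * _ * _); apply: eq_bigr => i ij.
  by rewrite !upd_other // -val_eqE /= val_eqE.
rewrite -sumrB rpred_sum // => x _.
rewrite monomial_slots permuteE smax -mulrBl memv_mul ?mem_espan //.
under eq_bigr => i _ do rewrite permuteE.
have := move_factor (g := g x) (j := j) bracket_Dspan (fun i => mem_Dspan _ _)
  (index_enum_uniq 'I_r) (mem_index_enum j).
by rewrite size_index_ord.
Qed.

Variable M : {vspace A}.
Hypothesis M_center : forall z, z \in agenv Dspan ->
  (forall a b, bracket (D a b) z = 0) -> z \in M.
Hypothesis M_omega : forall x, x \in M -> x * omega \in M.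

(** Induction on the number of letters. In the linked case the erased word [G] and the error of
    [tensor_map_linked] are both invariant of lower level, so both lie in [M]; [M_omega] then
    restores the factor [omega]. For the application [M] is [JM_algebra m.+1], and [M_center] is the
    induction hypothesis on the number of columns. *)
Lemma invariant_level r x :
  x \in level r -> (forall a b, bracket (D a b + e a b) x = 0) -> x \in M.
Proof.
elim: r x => [|r IH] x.
  by rewrite /level /expv_lt big_ord0 prod0v memv0 => /eqP -> _; rewrite mem0v.
move=> xr xT; have [N [l [xE lr NT]]] := lift_invariant xr xT.
have permM s : tensor_map (@slots r) (perm_op R d s) \in M.
  have sT a b := tensor_map_perm_invariant s a b (@slots_equivariant r).
  case: (unliftP ord_max (s ord_max)) => [j sj|smax]; last first.
    have xD := tensor_map_fixed smax; apply: M_center => // a b.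
    by have := sT a b; rewrite bracketDl agenv_Dspan_comm_e // addr0.
  have {}sj : s ord_max = low j.
    by rewrite sj; apply/val_inj; rewrite /= /bump leqNgt ltn_ord.
  set G := tensor_map (@fill r (low j)) (perm_op R d (tperm (low j) ord_max * s)).
  have GT a b : bracket (D a b + e a b) G = 0.
    exact: (tensor_map_perm_invariant _ _ _ (@fill_equivariant r (low j))).
  have GM : d%:R^-1 *: (G * omega) \in M.
    by rewrite rpredZ // M_omega // IH // tensor_map_fill.
  rewrite -(subrK (d%:R^-1 *: (G * omega)) (tensor_map _ _)) rpredD //.
  apply: IH; first exact: tensor_map_linked.
  move=> a b; rewrite linearB linearZ /= sT bracketM GT (comm_omega a b).
  by rewrite mul0r mulr0 addr0 scaler0 subrr.
have NM : tensor_map (@slots r) N \in M.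
  have : N \in <<[seq perm_op R d s | s in Sym [set: 'I_r.+1]]>>%VS.
    apply: comm_sum_perm_op => // [a b|j a b]; last by rewrite inE.
    apply/cent1vP; have /eqP := NT a b; rewrite bracket_eq0 => /eqP.
    rewrite (_ : total_op R r.+1 a b = site_sum R [set: 'I_r.+1] a b) //.
    by apply: eq_bigl => i; rewrite inE.
  suff /subvP h : (<<[seq perm_op R d s | s in Sym [set: 'I_r.+1]]>> <=
      linfun (tensor_map (@slots r)) @^-1: M)%VS.
    by move/h; rewrite -memv_preim lfunE.
  by apply/span_subvP => _ /imageP[s _ ->]; rewrite -memv_preim lfunE /= permM.
rewrite xE rpredD // IH // => a b.
have := xT a b; rewrite xE linearD /=.
have -> := tensor_map_bracket d_gt0 a b N (@slots_equivariant r).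
by rewrite NT linear0 add0r.
Qed.

End Peel.

(** * Adjoining a commuting matrix algebra and removing it again *)

Section MatrixUnitExtension.
Variables (R : realType) (d : nat).
Hypothesis d_gt0 : (0 < d)%N.
Variables (A : falgType R[i]) (e : 'I_d -> 'I_d -> A) (G : {vspace A}).
Hypothesis mul_e : forall a b x y, e a b * e x y = (b == x)%:R *: e a y.
Hypothesis sum_e : \sum_a e a a = 1.
Hypothesis commGe : forall a b, (G <= 'C[e a b])%VS.

Lemma agenv_comm a b z : z \in agenv G -> e a b * z = z * e a b.
Proof.
move=> zG; suff /subvP/(_ z zG)/cent1vP : (agenv G <= 'C[e a b])%VS by [].
apply: agenv_sub_modl; first by rewrite -memvE cent1v1.
by apply/prodvP => u v /(subvP (commGe a b)) uC vC; apply: memvM.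
Qed.

(** Letters [e] commute with [G] and multiply to letters [e], so every word can be sorted into a
    part in [G] followed by one [e]. *)
Lemma agenv_extend : (agenv (G + espan e) <= agenv G * espan e)%VS.
Proof.
have ee : (espan e * espan e <= espan e)%VS.
  apply: span_prodv_sub => _ _ /imageP[[a b] _ ->] /imageP[[x y] _ ->] /=.
  by rewrite mul_e rpredZ // mem_espan.
apply: agenv_sub_modl.
  rewrite -memvE -[1]mulr1 -{2}sum_e memv_mul //.
    by rewrite (subvP (sub1_agenv _)) // memv_line.
  by rewrite rpred_sum // => a _; rewrite mem_espan.
rewrite prodvDl subv_add; apply/andP; split.
  by rewrite prodvA prodvSl // {2}agenvEl addvSr.
have eG : (espan e * agenv G <= agenv G * espan e)%VS.
  apply/prodvP => u z ue zG.
  suff /subvP/(_ u ue) : (espan e <= amulr z @^-1: (agenv G * espan e))%VS.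
    by rewrite -memv_preim lfunE.
  apply/span_subvP => _ /imageP[[a b] _ ->]; rewrite -memv_preim lfunE /=.
  by rewrite agenv_comm // memv_mul ?mem_espan.
rewrite prodvA; apply: subv_trans (prodvSl _ eG) _.
by rewrite -prodvA prodvSr.
Qed.

(** The map [avg] is a partial trace: it sends [g * e s t] to [g] or 0, and multiplies by [d]
    whatever commutes with the matrix units. *)
Lemma agenv_drop x : x \in agenv (G + espan e) ->
  (forall a b, e a b * x = x * e a b) -> x \in agenv G.
Proof.
move=> /(subvP agenv_extend) xG xe.
pose avg := (\sum_a \sum_b (amulr (e b a) \o amull (e a b))%VF) : 'End(A).
have avgE z : avg z = \sum_a \sum_b e a b * z * e b a.
  rewrite sum_lfunE; apply: eq_bigr => a _; rewrite sum_lfunE.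
  by apply: eq_bigr => b _; rewrite comp_lfunE !lfunE.
have avgx : avg x = x *+ d.
  rewrite avgE.
  under eq_bigr => a _ do under eq_bigr => b _ do
    rewrite xe -mulrA mul_e eqxx scale1r.
  rewrite exchange_big /= -mulr_sumr sum_e mulr1 sumr_const.
  by rewrite card_ord.
suff : x *+ d \in agenv G.
  rewrite -[x *+ d]scaler_nat => /(rpredZ d%:R^-1).
  by rewrite scalerA mulVf ?natf_d_neq0 // scale1r.
rewrite -avgx; suff /subvP/(_ x xG) : (agenv G * espan e <= avg @^-1: agenv G)%VS.
  by rewrite -memv_preim.
apply/prodvP => g u gG ue.
suff /subvP/(_ u ue) : (espan e <= (avg \o amull g)%VF @^-1: agenv G)%VS.
  by rewrite -!memv_preim comp_lfunE lfunE.
apply/span_subvP => _ /imageP[[s t] _ ->] /=.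
rewrite -memv_preim comp_lfunE lfunE /= avgE exchange_big rpred_sum // => b _.
rewrite (eq_bigr (fun a => ((b == s)%:R * (t == b)%:R) *: (g * e a a))).
  by rewrite -scaler_sumr -mulr_sumr sum_e mulr1 rpredZ.
move=> a _; rewrite mulrA agenv_comm // -!mulrA (mulrA (e a b)) mul_e.
by rewrite -scalerAl mul_e scalerA -scalerAr.
Qed.

End MatrixUnitExtension.

(** * Partial transposition: from walled Brauer diagrams to permutations *)

Section PartialTranspose.
Variables (R : realType) (d : nat).
Hypothesis d_gt0 : (0 < d)%N.
Variables (p n : nat).
Local Notation E := (endo R d n).
Local Notation left := (@left_of_wall p n).
Implicit Types (x y : word d n) (M : E) (i j : 'I_n).

Definition mix x y : word d n := [ffun j => if left j then x j else y j].

Lemma mixK x y : mix (mix x y) (mix y x) = x.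
Proof. by apply/ffunP => j; rewrite !ffunE; case: (left j). Qed.

Lemma mix_updl x y j b :
  mix (upd x j b) y = if left j then upd (mix x y) j b else mix x y.
Proof.
by apply/ffunP => i; case: ifP => lj; rewrite !ffunE; case: (eqVneq i j) => // ->;
  rewrite lj.
Qed.

Lemma mix_updr x y j b :
  mix x (upd y j b) = if left j then mix x y else upd (mix x y) j b.
Proof.
by apply/ffunP => i; case: ifP => lj; rewrite !ffunE; case: (eqVneq i j) => // ->;
  rewrite lj.
Qed.

(* Transposition of the tensor factors to the right of the wall. *)
Definition ptrans M : E := operator (fun x y => entry M (mix x y) (mix y x)).

Lemma entry_ptrans M x y : entry (ptrans M) x y = entry M (mix x y) (mix y x).
Proof. exact: entry_operator. Qed.

Lemma ptransK : involutive ptrans.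
Proof.
by move=> M; apply: (entryP d_gt0) => x y; rewrite !entry_ptrans !mixK.
Qed.

Lemma ptransD M N : ptrans (M + N) = ptrans M + ptrans N.
Proof.
by apply: (entryP d_gt0) => x y; rewrite entryD !entry_ptrans entryD.
Qed.

Lemma ptransZ c M : ptrans (c *: M) = c *: ptrans M.
Proof.
by apply: (entryP d_gt0) => x y; rewrite entryZ !entry_ptrans entryZ.
Qed.

Lemma ptrans0 : ptrans 0 = 0.
Proof. by have := ptransZ 0 0; rewrite !scale0r. Qed.

Lemma ptransN M : ptrans (- M) = - ptrans M.
Proof. by rewrite -scaleN1r ptransZ scaleN1r. Qed.

Lemma ptrans_sum I (r : seq I) (P : pred I) (F : I -> E) :
  ptrans (\sum_(k <- r | P k) F k) = \sum_(k <- r | P k) ptrans (F k).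
Proof. exact: (big_morph ptrans ptransD ptrans0). Qed.

Lemma ptrans1 : ptrans 1 = 1.
Proof.
apply: (entryP d_gt0) => x y; rewrite entry_ptrans !entry1 //.
congr ((_ : bool)%:R); apply/eqP/eqP => [h|-> //].
by rewrite -[LHS](mixK x y) -[RHS](mixK y x) h.
Qed.

(** Transposition reverses products, so to the right of the wall the unit changes sides and is
    itself transposed. In a bracket this reverses the sign, whence the dual action in [gl_op]. *)
Lemma unit_op_ptrans j a b M : unit_op R j a b * ptrans M =
  if left j then ptrans (unit_op R j a b * M) else ptrans (M * unit_op R j b a).
Proof.
case: ifP => lj; apply: (entryP d_gt0) => x y;
  rewrite entry_unit_opl // !entry_ptrans ?entry_unit_opl ?entry_unit_opr //;
  by rewrite mix_updl mix_updr lj ffunE lj.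
Qed.

Lemma ptrans_unit_op j a b M : ptrans M * unit_op R j a b =
  if left j then ptrans (M * unit_op R j a b) else ptrans (unit_op R j b a * M).
Proof.
case: ifP => lj; apply: (entryP d_gt0) => x y;
  rewrite entry_unit_opr // !entry_ptrans ?entry_unit_opl ?entry_unit_opr //;
  by rewrite mix_updl mix_updr lj ffunE lj.
Qed.

(* The action of the matrix unit (a, b) of gl_d on the j-th factor, where the
   factors on the side t of the wall are C^d and the other ones its dual. *)
Definition gl_op t j a b : E :=
  if left j == t then unit_op R j a b else - unit_op R j b a.

Lemma bracket_ptrans j a b M :
  bracket (unit_op R j a b) (ptrans M) = ptrans (bracket (gl_op true j a b) M).
Proof.
rewrite /bracket unit_op_ptrans ptrans_unit_op /gl_op.
case: (left j); rewrite /= -ptransN -ptransD //.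
by rewrite mulNr mulrN opprK addrC.
Qed.

Definition gl_sum t k a b : E := \sum_(j < n | (j < k)%N) gl_op t j a b.

Definition columns k : {set 'I_n} := [set j : 'I_n | (j < k)%N].

Lemma bracket_suml (A : falgType R[i]) I (r : seq I) (P : pred I) (F : I -> A) (x : A) :
  bracket (\sum_(k <- r | P k) F k) x = \sum_(k <- r | P k) bracket (F k) x.
Proof. by rewrite /bracket mulr_suml mulr_sumr sumrB. Qed.

Lemma bracket_site_sum_ptrans k a b M :
  bracket (site_sum R (columns k) a b) (ptrans M) =
  ptrans (bracket (gl_sum true k a b) M).
Proof.
rewrite /site_sum /gl_sum !bracket_suml ptrans_sum.
by apply: eq_big => [j|j _]; rewrite ?inE ?bracket_ptrans.
Qed.

(* Matched nodes are always of the form [neg j] and [pos i], so that a walled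
   Brauer diagram amounts to a permutation. *)
Definition pos j : node n := (left j, j).
Definition neg j : node n := (~~ left j, j).

(** After mixing, the nodes [pos] and [neg] carry the labels [x] and [y], as the two rows of a
    permutation diagram do. *)
Lemma node_label_pos x y j : node_label (mix x y) (mix y x) (pos j) = x j.
Proof. by rewrite /node_label /=; case: ifP => lj; rewrite ffunE lj. Qed.

Lemma node_label_neg x y j : node_label (mix x y) (mix y x) (neg j) = y j.
Proof.
rewrite /node_label /=; case: (boolP (left j)) => lj;
  by rewrite /= ffunE ?lj ?(negPf lj).
Qed.

Lemma node_pos_neg (v : node n) : v = pos v.2 \/ v = neg v.2.
Proof. by case: v => r j; rewrite /pos /neg /=; case: r; case: (left j); auto. Qed.

Lemma diagramK (f : diagram p n) : involutive f.
Proof.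
by case: f => f /= /andP[/forallP h _] v; have /andP[_ /eqP] := h v.
Qed.

Lemma compatible_mix (f : diagram p n) (s : {perm 'I_n}) x y :
  (forall j, f (neg j) = pos (s j)) ->
  compatible f (mix x y) (mix y x) = (y == permute x s).
Proof.
move=> fs; apply/forallP/eqP => [h|-> v].
  apply/ffunP => j; rewrite permuteE; apply/esym/eqP.
  by have := h (neg j); rewrite fs node_label_pos node_label_neg.
have [->|->] := node_pos_neg v; last first.
  by rewrite fs node_label_pos node_label_neg permuteE.
have -> : pos v.2 = f (neg (s^-1%g v.2)) by rewrite fs permKV.
by rewrite diagramK fs node_label_pos node_label_neg permuteE.
Qed.

Lemma psi_diagram_ptrans (f : diagram p n) (s : {perm 'I_n}) :
  (forall j, f (neg j) = pos (s j)) ->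
  psi R p d n (basis_vec R f) = ptrans (perm_op R d s).
Proof.
move=> fs; rewrite -[LHS]ptransK; congr ptrans; apply: (entryP d_gt0) => x y.
rewrite entry_ptrans entry_operator // -(compatible_mix x y fs).
exact: psi_coefE.
Qed.

Lemma diagram_neg (f : diagram p n) j : f (neg j) = pos (f (neg j)).2.
Proof.
case: f => f /= /andP[_ /forallP/(_ (neg j))]; case: (f _) => r i /=.
rewrite /pos /=; case: eqP => [-> /eqP|h /eqP ->].
  by case: (left i); case: (left j).
by congr pair; case: r (left j) h => [] [].
Qed.

Lemma diagram_perm (f : diagram p n) :
  exists s : {perm 'I_n}, forall j, f (neg j) = pos (s j).
Proof.
have inj : injective (fun j => (f (neg j)).2).
  move=> i j h; have : f (neg i) = f (neg j) by rewrite diagram_neg h -diagram_neg.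
  by move/(can_inj (diagramK f)) => [].
by exists (perm inj) => j; rewrite permE -diagram_neg.
Qed.

End PartialTranspose.

(** * The diagram on m columns attached to a permutation of the first m columns *)

Section Restriction.
Variables (p m n : nat) (le_mn : (m <= n)%N) (s : {perm 'I_n}).
Hypothesis s_on : perm_on (columns n m) s.

Lemma perm_lt (j : 'I_m) : (s (widen_ord le_mn j) < m)%N.
Proof.
have := perm_closed (widen_ord le_mn j) s_on.
by rewrite !inE /= ltn_ord.
Qed.

Definition restrict_perm_fun (j : 'I_m) : 'I_m := Ordinal (perm_lt j).

Lemma widen_restrict j : widen_ord le_mn (restrict_perm_fun j) = s (widen_ord le_mn j).
Proof. exact: val_inj. Qed.

Lemma restrict_perm_inj : injective restrict_perm_fun.
Proof.
move=> i j /(congr1 (widen_ord le_mn)); rewrite !widen_restrict => /perm_inj.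
by move/(congr1 val) => /= h; apply: val_inj.
Qed.

Definition restrict_perm := perm restrict_perm_inj.

(** The test [v.1 == left_of_wall p v.2] recognises the nodes of the form [pos]. *)
Definition raw_of_perm : {ffun node m -> node m} :=
  [ffun v => if v.1 == left_of_wall p v.2 then neg p (restrict_perm^-1%g v.2)
             else pos p (restrict_perm v.2)].

Lemma raw_of_perm_subproof :
  perfect_matching raw_of_perm && respects_wall p raw_of_perm.
Proof.
apply/andP; split; apply/forallP => -[r j]; rewrite !ffunE /=.
  have nb (b : bool) : (~~ b == b) = false by case: b.
  case: (eqVneq r (left_of_wall p j)) => [->|rj] /=.
    rewrite nb permKV /pos eqxx andbT xpair_eqE.
    by case: (eqVneq (restrict_perm^-1%g j) j) => [->|_]; rewrite ?nb ?andbF.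
  rewrite eqxx permK !xpair_eqE eqxx andbT; apply/andP; split; last first.
    by move: rj; case: r; case: left_of_wall.
  case: (eqVneq (restrict_perm j) j) => [->|_]; rewrite ?andbF // andbT.
  by rewrite eq_sym.
case: (eqVneq r (left_of_wall p j)) => [->|rj] /=.
  by case: left_of_wall; case: left_of_wall.
by move: rj; case: r; case: left_of_wall => // _; case: left_of_wall.
Qed.

Definition diagram_of_perm : diagram p m := Diagram raw_of_perm_subproof.

Lemma embed_diagram_of_perm j : embed le_mn diagram_of_perm (neg p j) = pos p (s j).
Proof.
rewrite ffunE /=; case: insubP => [i lt_im def_i|ge_im] /=.
  have lj : left_of_wall p i = left_of_wall p j by rewrite /left_of_wall def_i.
  have ij : widen_ord le_mn i = j by apply: val_inj.
  rewrite ffunE /= lj; have -> : (~~ left_of_wall p j == left_of_wall p j) = false.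
    by case: left_of_wall.
  by rewrite /pos /= permE -ij -widen_restrict.
by rewrite (out_perm s_on) ?inE // /pos negbK.
Qed.

End Restriction.

(** * The mixed action of gl_d and the images of the generating diagrams *)

Section GlOperators.
Variables (R : realType) (d : nat).
Hypothesis d_gt0 : (0 < d)%N.
Variables (p n : nat).
Local Notation E := (endo R d n).
Local Notation left := (@left_of_wall p n).
Local Notation e := (@unit_op R d n).
Local Notation gl := (@gl_op R d p n).
Local Notation glsum := (@gl_sum R d p n).
Implicit Types (i j : 'I_n) (t : bool).

(** Exchanging C^d with its dual is the automorphism E_ab -> -E_ba of gl_d; hence both values of [t]
    define the same commutant. *)
Lemma gl_op_flip t j a b : gl (~~ t) j a b = - gl t j b a.
Proof. by rewrite /gl_op; case: (left j); case: t; rewrite /= ?opprK. Qed.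

Lemma gl_sum_flip t k a b : glsum (~~ t) k a b = - glsum t k b a.
Proof. by rewrite /gl_sum -sumrN; apply: eq_bigr => j _; rewrite gl_op_flip. Qed.

Lemma adjointN (x : E) : adjoint (- x) = - adjoint x.
Proof. by rewrite -scaleN1r adjointZ rmorphN1 scaleN1r. Qed.

Lemma adjoint_gl_sum t k a b : adjoint (glsum t k a b) = glsum t k b a.
Proof.
rewrite /gl_sum adjoint_sum; apply: eq_bigr => j _; rewrite /gl_op.
by case: ifP => _; rewrite ?adjointN adjoint_unit_op.
Qed.

Lemma bracket_unit_op j a b x y : bracket (e j a b) (e j x y) =
  (b == x)%:R *: e j a y - (a == y)%:R *: e j x b.
Proof. by rewrite /bracket !unit_opM // [y == a]eq_sym. Qed.

Lemma bracket_unit_op0 i j a b x y : i != j -> bracket (e i a b) (e j x y) = 0.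
Proof. by move=> ij; apply/eqP; rewrite bracket_eq0 unit_opC. Qed.

Lemma bracketNl (A : falgType R[i]) (x y : A) : bracket (- x) y = - bracket x y.
Proof. by rewrite /bracket mulNr mulrN opprB opprK addrC. Qed.

Lemma bracketNr (A : falgType R[i]) (x y : A) : bracket x (- y) = - bracket x y.
Proof. exact: linearN. Qed.

Lemma bracket_gl_op t j a b x y : bracket (gl t j a b) (gl t j x y) =
  (b == x)%:R *: gl t j a y - (a == y)%:R *: gl t j x b.
Proof.
rewrite /gl_op; case: ifP => _; first exact: bracket_unit_op.
rewrite bracketNl bracketNr opprK bracket_unit_op !scalerN opprK addrC.
by rewrite [a == y]eq_sym [b == x]eq_sym; congr (_ + _).
Qed.

Lemma bracket_gl_unit_op t i j a b x y : i != j ->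
  bracket (gl t i a b) (e j x y) = 0.
Proof.
move=> ij; rewrite /gl_op; case: ifP => _; rewrite ?bracketNl bracket_unit_op0 //.
exact: oppr0.
Qed.

Lemma bracket_gl_op0 t i j a b x y : i != j ->
  bracket (gl t i a b) (gl t j x y) = 0.
Proof.
move=> ij; rewrite {2}/gl_op; case: ifP => _; rewrite ?bracketNr.
  exact: bracket_gl_unit_op.
by rewrite bracket_gl_unit_op // oppr0.
Qed.

Lemma gl_sum_equivariant t k : equivariant (glsum t k) (glsum t k).
Proof.
move=> a b x y; rewrite /gl_sum bracket_suml !scaler_sumr -sumrB.
apply: eq_bigr => i ik; rewrite linear_sum /= (bigD1 i) //= big1 ?addr0.
  exact: bracket_gl_op.
by move=> j /andP[_ ji]; rewrite bracket_gl_op0 // eq_sym.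
Qed.

Lemma bracket_gl_sum_unit_op t k j a b x y : (k <= j)%N ->
  bracket (glsum t k a b) (e j x y) = 0.
Proof.
move=> kj; rewrite /gl_sum bracket_suml big1 // => i ik.
by rewrite bracket_gl_unit_op // -val_eqE /= ltn_eqF // (leq_trans ik).
Qed.

Lemma gl_sumS t j a b : glsum t j.+1 a b = glsum t j a b + gl t j a b.
Proof.
rewrite /gl_sum (bigD1 j) //= addrC; congr (_ + _).
by apply: eq_bigl => i; rewrite ltnS andbC -ltn_neqAle.
Qed.

Lemma gl_op_same j a b : gl (left j) j a b = e j a b.
Proof. by rewrite /gl_op eqxx. Qed.

Lemma gl_sum0 t a b : glsum t 0 a b = 0.
Proof. by rewrite /gl_sum big_pred0. Qed.

Definition link t i j : E := \sum_a \sum_b gl t i a b * e j b a.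

Lemma omega_link t j : omega (glsum t j) (e j) = \sum_(i < n | (i < j)%N) link t i j.
Proof.
rewrite /omega /link [RHS]exchange_big /=; apply: eq_bigr => a _.
by rewrite [RHS]exchange_big /=; apply: eq_bigr => b _; rewrite mulr_suml.
Qed.

Lemma perm_op_tperm i j : i != j ->
  perm_op R d (tperm i j) = \sum_a \sum_b e i a b * e j b a.
Proof.
move=> ij; apply: (entryP d_gt0) => x y; rewrite entry_operator // entry_sum.
rewrite (bigD1 (x i)) //= [X in _ + X]big1 ?addr0 => [|a ax]; last first.
  rewrite entry_sum big1 // => b _.
  by rewrite entry_unit_opl // eq_sym (negPf ax) mul0r.
have ji : j != i by rewrite eq_sym.
rewrite entry_sum (bigD1 (x j)) //= big1 ?addr0 => [|b bx]; last first.
  rewrite entry_unit_opl // entry_operator // upd_other // [x j == b]eq_sym.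
  by rewrite (negPf bx) mulr0.
rewrite entry_unit_opl // entry_operator // eqxx mul1r upd_other // eqxx /=.
congr ((_ == _)%:R); apply/ffunP => l; rewrite permuteE.
case: tpermP => [->|->|/eqP li /eqP lj]; last by rewrite !upd_other.
- by rewrite upd_other // upd_same.
- by rewrite upd_same.
Qed.

Lemma ptrans_unit j a b :
  ptrans p (e j a b) = if left j then e j a b else e j b a.
Proof.
rewrite -[in LHS](mulr1 (e j a b)); case: ifP => lj.
  by have := unit_op_ptrans d_gt0 p j a b (1 : E); rewrite lj ptrans1 // mulr1 => <-.
by have := ptrans_unit_op d_gt0 p j b a (1 : E); rewrite lj ptrans1 // mul1r => <-.
Qed.

(** On one side of the wall the link is the flip of two factors; across the wall it is a partially
    transposed flip, and the dual action adds the minus sign that the contractions have in [JB]. *)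
Lemma link_ptrans i j : i != j -> left i || ~~ left j ->
  link (left j) i j =
  if left i == left j then ptrans p (perm_op R d (tperm i j))
  else - ptrans p (perm_op R d (tperm i j)).
Proof.
move=> ij lij; rewrite perm_op_tperm // ptrans_sum //.
under [in RHS]eq_bigr => a _ do rewrite ptrans_sum //.
rewrite /link /gl_op; case li : (left i) lij => /=; case lj : (left j) => //= _.
- apply: eq_bigr => a _; apply: eq_bigr => b _.
  by have := unit_op_ptrans d_gt0 p i a b (e j b a);
    rewrite li => <-; rewrite ptrans_unit lj.
- rewrite exchange_big -sumrN /=; apply: eq_bigr => a _.
  rewrite -sumrN; apply: eq_bigr => b _; rewrite mulNr; congr (- _).
  by have := unit_op_ptrans d_gt0 p i a b (e j b a);
    rewrite li => <-; rewrite ptrans_unit lj.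
rewrite exchange_big /=; apply: eq_bigr => a _; apply: eq_bigr => b _.
have := ptrans_unit_op d_gt0 p i b a (e j b a).
by rewrite li => <-; rewrite ptrans_unit lj unit_opC.
Qed.

Lemma psi_transposition i j : i != j -> left i = left j ->
  psi R p d n (basis_vec R (transposition p i j)) = link (left j) i j.
Proof.
move=> ij lij; rewrite link_ptrans //; last by rewrite lij orbN.
rewrite lij eqxx; apply: psi_diagram_ptrans => // k.
rewrite transpositionE // ffunE /= negbK /pos; case: tpermP => [->|->|/eqP ki /eqP kj].
- by rewrite eqxx lij.
- by rewrite eqxx eq_sym (negPf ij) lij.
- by rewrite (negPf ki) (negPf kj).
Qed.

Lemma psi_contraction i j : left i -> ~~ left j ->
  psi R p d n (basis_vec R (contraction p i j)) = - link (left j) i j.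
Proof.
move=> li lj; have ij : i != j by apply: contraNneq lj => <-.
rewrite link_ptrans //; last by rewrite li.
rewrite li (negPf lj) /= opprK; apply: psi_diagram_ptrans => // k.
rewrite contractionE ?li ?(negPf lj) // ffunE /= /pos.
case: tpermP => [->|->|/eqP ki /eqP kj].
- by rewrite eqxx li (negPf lj).
- by rewrite eqxx eq_sym (negPf ij) li (negPf lj).
- by rewrite (negPf ki) (negPf kj) negbK.
Qed.

Lemma psi_vertical : psi R p d n (basis_vec R (vertical p n)) = 1.
Proof.
rewrite -(ptrans1 R d_gt0 p n) -(perm_op1 R d_gt0).
by apply: psi_diagram_ptrans => // j; rewrite ffunE perm1 /neg /pos /= negbK.
Qed.

End GlOperators.

(** * The algebras A_k as commutants, and the Casimir operator *)

Section Centers.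
Variables (R : realType) (p q d : nat).
Hypothesis d_gt0 : (0 < d)%N.
Local Notation n := (p + q)%N.
Local Notation E := (endo R d n).
Local Notation left := (@left_of_wall p n).
Local Notation e := (@unit_op R d n).
Local Notation glsum := (@gl_sum R d p n).
Local Notation algA := (@algA R p q d).
Local Notation JA := (@JA R p q d).
Implicit Types (i j c : 'I_n) (k : 'I_n.+1) (t : bool) (x : E).

Lemma brauer_embed_basis k (s : diagram p k) :
  brauer_embed R p (leq_ord k) (basis_vec R s) = basis_vec R (embed (leq_ord k) s).
Proof.
rewrite lfunE /= /brauer_embed_fun (bigD1 s) //= big1 ?addr0 => [|u us].
  by rewrite ffunE eqxx scale1r.
by rewrite ffunE (negPf us) scale0r.
Qed.

Lemma psi_embed_algA k (s : diagram p k) :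
  psi R p d n (basis_vec R (embed (leq_ord k) s)) \in algA k.
Proof. by rewrite -brauer_embed_basis !memv_img // memvf. Qed.

Lemma algA_ind k (V : {vspace E}) :
  (forall s : diagram p k, psi R p d n (basis_vec R (embed (leq_ord k) s)) \in V) ->
  (algA k <= V)%VS.
Proof.
move=> sV; apply/subvP => _ /memv_imgP[_ /memv_imgP[b _ ->] ->].
have -> : brauer_embed R p (leq_ord k) b =
    \sum_s b s *: basis_vec R (embed (leq_ord k) s) by rewrite lfunE.
by rewrite linear_sum rpred_sum // => s _; rewrite linearZ /= rpredZ ?sV.
Qed.

Definition comm_gl k x : Prop :=
  (forall a b, bracket (glsum true k a b) x = 0) /\
  (forall j a b, (k <= j)%N -> bracket (e j a b) x = 0).

Lemma ptrans_inj : injective (@ptrans R d p n).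
Proof. by apply: can_inj; apply: ptransK. Qed.

Lemma bracket_gl_op_eq0 j x :
  (forall a b, bracket (gl_op R p true j a b) x = 0) <->
  (forall a b, bracket (e j a b) x = 0).
Proof.
rewrite /gl_op; case: (left j == true) => /=; first by split=> h a b; exact: h.
split=> h a b; last by rewrite bracketNl h oppr0.
by apply/eqP; rewrite -oppr_eq0 -bracketNl h.
Qed.

(** After partial transposition a diagram with vertical edges beyond column k is a permutation
    fixing those columns, and such a permutation commutes with the site sum and with the remaining
    matrix units. *)
Lemma algA_comm_gl k x : x \in algA k -> comm_gl k x.
Proof.
move=> xA; have bV (u y : E) : (y \in 'C[u]%VS) = (bracket u y == 0).
  by rewrite bracket_eq0 eq_sym; apply/cent1vP/eqP.
have gen (s : diagram p k) :
    comm_gl k (psi R p d n (basis_vec R (embed (leq_ord k) s))).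
  have [w sw] := diagram_perm (embed (leq_ord k) s).
  have w_on : perm_on (columns n k) w.
    apply/subsetP => j; rewrite !inE; apply: contraNT; rewrite -leqNgt => kj.
    have := sw j; rewrite ffunE /=; case: insubP => [i|_].
      by rewrite ltnNge kj.
    by case=> _ /esym/eqP.
  rewrite (psi_diagram_ptrans _ d_gt0 sw); split=> [a b|j a b kj].
    apply: ptrans_inj; rewrite -bracket_site_sum_ptrans // ptransK //.
    apply/eqP; rewrite ptrans0 // bracket_eq0; apply/eqP.
    by apply: site_sum_perm_op; rewrite // inE.
  move: a b; apply/bracket_gl_op_eq0 => a b; apply: ptrans_inj.
  rewrite -bracket_ptrans // ptransK // ptrans0 //; apply/eqP.
  rewrite bracket_eq0; apply/eqP/esym.
  by rewrite perm_op_unit_op // (out_perm w_on) // inE -leqNgt.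
split=> [a b|j a b kj]; apply/eqP; rewrite -bV; move: x xA; apply/subvP;
  apply: algA_ind => s; rewrite bV; have [h1 h2] := gen s.
- by rewrite h1.
- by rewrite h2.
Qed.

(** The transposed operator satisfies the hypotheses of [comm_sum_perm_op], and each permutation in
    the resulting expansion comes from a diagram on k columns. *)
Lemma comm_gl_algA k x : comm_gl k x -> x \in algA k.
Proof.
case=> h1 h2; rewrite -(ptransK d_gt0 p x).
have bC (u y : E) : bracket u y = 0 -> u \in 'C[y]%VS.
  by move/eqP; rewrite bracket_eq0 => /eqP h; apply/cent1vP.
have /(coord_span (X := in_tuple _)) : ptrans p x \in
    <<[seq perm_op R d s | s in Sym (columns n k)]>>%VS.
  apply: comm_sum_perm_op => // [a b|j a b].
    by apply: bC; rewrite bracket_site_sum_ptrans // h1 ptrans0.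
  rewrite inE -leqNgt => kj; apply: bC; rewrite bracket_ptrans //.
  have /bracket_gl_op_eq0 -> : forall a b, bracket (e j a b) x = 0.
    by move=> *; exact: h2.
  exact: ptrans0.
move=> ->; rewrite ptrans_sum // rpred_sum // => i _.
rewrite ptransZ // rpredZ //=.
have /imageP[s sU ->] : [seq perm_op R d s | s in Sym (columns n k)]`_i \in
    [seq perm_op R d s | s in Sym (columns n k)] by apply: mem_nth.
have s_on : perm_on (columns n k) s by rewrite inE in sU.
rewrite -(psi_diagram_ptrans R d_gt0 (embed_diagram_of_perm p (leq_ord k) s_on)).
exact: psi_embed_algA.
Qed.

Lemma comm_gl_side t k x : comm_gl k x ->
  forall a b, bracket (glsum t k a b) x = 0.
Proof.
case=> h _ a b; case: t; first exact: h.
have -> : glsum false k a b = - glsum true k b a by rewrite -gl_sum_flip.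
by rewrite bracketNl h oppr0.
Qed.

Lemma comm_gl_of_side t k x : (forall a b, bracket (glsum t k a b) x = 0) ->
  (forall j a b, (k <= j)%N -> bracket (e j a b) x = 0) -> comm_gl k x.
Proof.
move=> h1 h2; split; last exact: h2.
move=> a b; case: t h1 => h1; first exact: h1.
have -> : glsum true k a b = - glsum false k b a by rewrite -gl_sum_flip.
by rewrite bracketNl h1 oppr0.
Qed.

(** Compared through commutants, which avoids composing embeddings: [x] commutes with the columns
    that are added to the site sum. *)
Lemma algA_mono k k' : (k <= k')%N -> (algA k <= algA k')%VS.
Proof.
move=> kk; apply/subvP => x /algA_comm_gl[h1 h2]; apply: comm_gl_algA.
split=> [a b|j a b kj]; last by apply: h2; exact: leq_trans kj.
rewrite /gl_sum (bigID (fun j : 'I_n => (j < k)%N)) /= bracketDl.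
rewrite (eq_bigl (fun j : 'I_n => (j < k)%N)); last first.
  move=> j; case: (ltnP j k) => jk; rewrite ?andbF // andbT.
  exact: leq_trans kk.
rewrite -/(glsum true k a b) h1 add0r bracket_suml big1 // => j /andP[_].
rewrite -leqNgt => kj.
have /bracket_gl_op_eq0 -> // : forall a b, bracket (e j a b) x = 0.
by move=> *; exact: h2.
Qed.

Definition wall_shift c : R[i] := if (c < p)%N then 0 else d%:R.

(** For the side [left c] transpositions are links and contractions are negatives of links, so all
    terms of [JB] but the constant add up to [omega]. *)
Lemma JA_omega c : JA c = omega (glsum (left c) c) (e c) + wall_shift c *: 1.
Proof.
rewrite omega_link /JA /JB /wall_shift; case: ifP => cp.
  rewrite scale0r addr0 linear_sum; apply: eq_bigr => i ic /=.
  by rewrite psi_transposition // ?(ltn_eqF ic) // -?val_eqE /= ?(ltn_eqF ic) //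
    /left_of_wall cp (ltn_trans ic).
rewrite linearD linearB linearZ /= psi_vertical // !linear_sum /=.
congr (_ + _); rewrite [RHS](bigID (fun i : 'I_n => (i < p)%N)) /= [LHS]addrC.
have pc : (p <= c)%N by rewrite leqNgt cp.
congr (_ + _).
  apply: eq_big => [i|i ip].
    by case: (ltnP i p) => ip; rewrite ?andbF // andbT (leq_trans ip).
  by rewrite psi_contraction ?opprK // /left_of_wall ?cp ?ip.
apply: eq_big => [i|i /andP[pi ic]]; first by rewrite -leqNgt andbC.
rewrite psi_transposition // -?val_eqE /= ?(ltn_eqF ic) //.
by rewrite /left_of_wall cp ltnNge pi.
Qed.

Lemma bracket_side c a b (u v : 'I_d) :
  bracket (glsum (left c) c a b) (e c u v) = 0.
Proof. exact: bracket_gl_sum_unit_op. Qed.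

Lemma gl_sum_side c a b :
  glsum (left c) c.+1 a b = glsum (left c) c a b + e c a b.
Proof. by rewrite gl_sumS gl_op_same. Qed.

Lemma JA_algA c : JA c \in algA (lift ord0 c).
Proof.
have b1 (u : E) : bracket u 1 = 0 by rewrite /bracket mulr1 mul1r subrr.
apply: comm_gl_algA; apply: (comm_gl_of_side (t := left c)) => [a b|j a b] /=.
  rewrite JA_omega linearD linearZ /= b1 scaler0 addr0 gl_sum_side.
  apply: comm_omega; [exact: gl_sum_equivariant|exact: bracket_side|].
  exact: unit_opM.
rewrite /bump leq0n add1n => cj; rewrite JA_omega linearD linearZ /= b1 scaler0 addr0.
rewrite /omega linear_sum big1 // => s _; rewrite linear_sum big1 // => u _.
have h1 : bracket (e j a b) (glsum (left c) c s u) = 0.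
  have /eqP := bracket_gl_sum_unit_op R d_gt0 p (left c) s u a b (ltnW cj).
  by rewrite bracket_eq0 eq_sym -bracket_eq0 => /eqP.
have h2 : bracket (e j a b) (e c u s) = 0.
  by apply: bracket_unit_op0 => //; rewrite -val_eqE /= gtn_eqF.
by apply: etrans (bracketM _ _ _) _; rewrite h1 h2 mul0r mulr0 addr0.
Qed.

Definition casimir t (m : nat) : E := \sum_a \sum_b glsum t m a b * glsum t m b a.

Lemma casimir_flip t m : casimir (~~ t) m = casimir t m.
Proof.
rewrite /casimir exchange_big; apply: eq_bigr => a _; apply: eq_bigr => b _.
by rewrite !gl_sum_flip mulrNN.
Qed.

Lemma casimir_side t t' m : casimir t m = casimir t' m.
Proof.
case: t; case: t'; [by [] | | | by []]; last exact: (casimir_flip true).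
exact: (esym (casimir_flip true m)).
Qed.

(** Expand the square of D + e: the cross terms give [omega] twice because D and e commute, and the
    sum of all [e a b * e b a] is [d]. *)
Lemma casimirS c : casimir true c.+1 =
  casimir true c + (omega (glsum (left c) c) (e c)) *+ 2 + 1 *+ d.
Proof.
rewrite !(casimir_side true (left c)) /casimir.
have -> : (1 : E) *+ d = \sum_a \sum_b e c a b * e c b a.
  under eq_bigr => a _ do under eq_bigr => b _ do rewrite unit_opM // eqxx scale1r.
  by rewrite exchange_big /= sum_unit_op // sumr_const card_ord.
have -> : omega (glsum (left c) c) (e c) *+ 2 = \sum_a \sum_b
    (glsum (left c) c a b * e c b a + e c a b * glsum (left c) c b a).
  rewrite mulr2n {2}/omega [X in _ + X]exchange_big /omega -big_split.
  apply: eq_bigr => a _; rewrite -big_split; apply: eq_bigr => b _ /=.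
  congr (_ + _); apply/eqP; rewrite -bracket_eq0.
  by rewrite bracket_side.
rewrite -!big_split; apply: eq_bigr => a _; rewrite -!big_split.
apply: eq_bigr => b _ /=; rewrite !gl_sum_side mulrDl !mulrDr.
by rewrite !addrA.
Qed.

Lemma sum_JA_casimir m : (m <= n)%N -> exists s : R[i],
  \sum_(i < n | (i < m)%N) JA i = 2%:R^-1 *: casimir true m + s *: 1.
Proof.
elim: m => [_|m IH mn].
  exists 0; rewrite big_pred0 // /casimir big1 ?scaler0 ?scale0r ?addr0 // => a _.
  by rewrite big1 // => b _; rewrite gl_sum0 mul0r.
have [s sE] := IH (ltnW mn); pose c := Ordinal mn.
(* [JA c] contributes [wall_shift c]; half the Casimir operator grows by [omega] and by d/2, and the
   latter is taken off again. *)
exists (s + wall_shift c - 2%:R^-1 * d%:R).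
rewrite (bigD1 c) //= (eq_bigl (fun i : 'I_n => (i < m)%N)); last first.
  by move=> i; rewrite ltnS andbC -val_eqE /= -ltn_neqAle.
rewrite sE JA_omega -[m]/(nat_of_ord c) casimirS.
have two : (2%:R : R[i]) != 0 by rewrite pnatr_eq0.
have half (w : E) : 2%:R^-1 *: (w *+ 2) = w.
  by rewrite -[w *+ 2]scaler_nat scalerA mulVf // scale1r.
have dE : 2%:R^-1 *: (1 *+ d : E) = (2%:R^-1 * d%:R) *: 1.
  by rewrite -[1 *+ d]scaler_nat scalerA.
rewrite 2!scalerDr half dE scalerBl scalerDl.
by rewrite -[RHS]addrA [X in _ = _ + X]addrC subrK [LHS]addrC addrACA.
Qed.

End Centers.

(** * The centers lie in the algebra generated by the Jucys-Murphy elements *)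

Section GelfandTsetlin.
Variables (R : realType) (p q d : nat).
Hypothesis d_gt0 : (0 < d)%N.
Local Notation n := (p + q)%N.
Local Notation E := (endo R d n).
Local Notation left := (@left_of_wall p n).
Local Notation e := (@unit_op R d n).
Local Notation glsum := (@gl_sum R d p n).
Local Notation algA := (@algA R p q d).
Local Notation JA := (@JA R p q d).
Implicit Types (i j c : 'I_n) (k : 'I_n.+1) (t : bool) (x : E).

(** The strict bound makes [m] the number of generators, so that [m = 0] gives the scalars and
    starts the induction. *)
Definition JM_algebra m : {vspace E} :=
  agenv <<[seq JA i | i <- enum 'I_n & (i < m)%N]>>%VS.

Lemma JM_algebraM m x y : x \in JM_algebra m -> y \in JM_algebra m ->
  x * y \in JM_algebra m.
Proof. by move=> xM yM; rewrite /JM_algebra -agenvM memv_mul. Qed.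

Lemma mem_JM_algebra m i : (i < m)%N -> JA i \in JM_algebra m.
Proof.
move=> im; apply: (subvP (sub_agenv _)); apply: memv_span; apply: map_f.
by rewrite mem_filter im mem_enum.
Qed.

Lemma JM_algebra1 m : 1 \in JM_algebra m.
Proof. by rewrite (subvP (sub1_agenv _)) // memv_line. Qed.

Lemma JM_algebra_mono m m' : (m <= m')%N -> (JM_algebra m <= JM_algebra m')%VS.
Proof.
move=> mm; apply: agenvS; apply/span_subvP => _ /mapP[i + ->].
rewrite mem_filter => /andP[im _].
by apply: memv_span; apply: map_f; rewrite mem_filter mem_enum (leq_trans im).
Qed.

Lemma agenv_drop_columns (G : {vspace E}) (r : seq 'I_n) x : uniq r ->
  (forall j a b, j \in r -> (G <= 'C[e j a b])%VS) ->
  (forall j a b, j \in r -> bracket (e j a b) x = 0) ->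
  x \in agenv (G + \sum_(j <- r) espan (e j)) -> x \in agenv G.
Proof.
elim: r => [|j r IH] /=; first by rewrite big_nil addv0.
case/andP => jr ur GC xC; rewrite big_cons [X in (_ + X)%VS]addvC addvA => xr.
apply: IH => // [i a b ir|i a b ir|].
- by apply: GC; rewrite inE ir orbT.
- by apply: xC; rewrite inE ir orbT.
apply: (agenv_drop d_gt0 _ _ _ xr) => [a b u v||a b|a b].
- exact: unit_opM.
- exact: sum_unit_op.
- rewrite subv_add GC ?mem_head //=; rewrite big_seq.
  elim/big_ind: _ => [|U V UC VC|i ir]; rewrite ?sub0v ?subv_add ?UC //.
  apply/span_subvP => _ /imageP[[u v] _ ->] /=.
  apply/cent1vP; apply: unit_opC => //.
  by apply: contraNneq jr => <-.
by apply/eqP; rewrite -bracket_eq0 xC ?mem_head.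
Qed.

(** The bicommutant theorem puts [x] into the algebra generated by the diagonal action on the
    columns before [c] and the matrix units of all columns from [c] on; the columns after [c] are
    then averaged away. *)
Lemma centralizer_agenv c x :
  (forall y, comm_gl (widen_ord (leqnSn n) c) y -> x * y = y * x) ->
  (forall j a b, (c < j)%N -> bracket (e j a b) x = 0) ->
  x \in agenv (Dspan (glsum (left c) c) + espan (e c)).
Proof.
move=> xA xC; pose r := [seq j : 'I_n <- enum 'I_n | (c < j)%N].
have rE j : (j \in r) = (c < j)%N by rewrite mem_filter mem_enum andbT.
apply: (@agenv_drop_columns _ r) => [|j a b|j a b|].
- by rewrite filter_uniq ?enum_uniq.
- rewrite rE => cj; rewrite subv_add; apply/andP; split;
    apply/span_subvP => _ /imageP[[u v] _ ->] /=; apply/cent1vP.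
    by apply/eqP; rewrite -bracket_eq0 bracket_gl_sum_unit_op // ltnW.
  by apply: unit_opC; rewrite // -val_eqE /= ltn_eqF.
- by rewrite rE; apply: xC.
pose X1 := [seq glsum (left c) c w.1 w.2 | w : 'I_d * 'I_d].
pose X2 := [seq e w.1 w.2.1 w.2.2 | w : 'I_n * ('I_d * 'I_d) in
  [pred w : 'I_n * ('I_d * 'I_d) | (c <= w.1)%N]].
have X1P a b : glsum (left c) c a b \in X1 ++ X2.
  by rewrite mem_cat; apply/orP; left; apply/imageP; exists (a, b).
have X2P j a b : (c <= j)%N -> e j a b \in X1 ++ X2.
  by move=> cj; rewrite mem_cat; apply/orP; right; apply/imageP; exists (j, (a, b)).
have : x \in agenv <<X1 ++ X2>>%VS.
  apply: endo_bicommutant => [u|y yX].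
    rewrite mem_cat => /orP[] /imageP.
      by case=> -[a b] _ ->; rewrite adjoint_gl_sum.
    by case=> -[j [a b]]; rewrite inE /= => cj ->; rewrite adjoint_unit_op // X2P.
  apply: xA; apply: (comm_gl_of_side (t := left c)).
    by move=> a b; apply/eqP; rewrite bracket_eq0 yX.
  by move=> j a b cj; apply/eqP; rewrite bracket_eq0 yX ?X2P.
apply/subvP; apply: agenvS; rewrite span_cat subv_add; apply/andP; split.
  by rewrite -addvA addvSl.
apply/span_subvP => _ /imageP[[j [a b]] + ->]; rewrite inE /= => cj.
have := mem_espan (e j) a b; apply/subvP.
case: (eqVneq j c) => [->|jc].
  by apply: subv_trans (addvSr _ _) (addvSl _ _).
apply: subv_trans (addvSr _ _).
rewrite big_filter big_mkcond /= (bigD1_seq j) ?mem_enum ?enum_uniq //=.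
rewrite (_ : (c < j)%N); first by rewrite addvSl.
by rewrite ltn_neqAle cj andbT eq_sym.
Qed.

Lemma center_JM_algebra m k : k = m :> nat -> ('Z(algA k) <= JM_algebra m)%VS.
Proof.
elim: m k => [|m IH] k km; apply/subvP => x /memv_capP[xA /centvP xZ].
  (* An element of A_0 commutes with all matrix units; for the empty set of columns only the
     identity permutation is left. *)
  have [_ xC] := algA_comm_gl d_gt0 xA.
  have : x \in <<[seq perm_op R d s | s in Sym (set0 : {set 'I_n})]>>%VS.
    apply: comm_sum_perm_op => // [a b|j a b _].
      by rewrite /site_sum big_set0 mem0v.
    by apply/cent1vP/eqP; rewrite -bracket_eq0 xC ?km.
  apply/subvP/span_subvP => _ /imageP[s + ->]; rewrite inE => s0.
  rewrite (_ : s = 1%g) ?perm_op1 ?JM_algebra1 //.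
  by apply/permP => j; rewrite perm1 (out_perm s0) ?inE.
have mn : (m < n)%N by rewrite -km -ltnS ltn_ord.
pose c := Ordinal mn; pose k' := widen_ord (leqnSn n) c.
have [xD xC] := algA_comm_gl d_gt0 xA.
have bs := bracket_side R d_gt0 c.
have ev : equivariant (glsum (left c) c) (glsum (left c) c).
  exact: gl_sum_equivariant.
have uM := unit_opM R d_gt0 c.
have cM : (JM_algebra m <= JM_algebra m.+1)%VS by apply: JM_algebra_mono.
have xG : x \in agenv (Dspan (glsum (left c) c) + espan (e c)).
  apply: centralizer_agenv => [y yc|j a b cj]; last by apply: xC; rewrite km.
  have kk : (k' <= k)%N by rewrite km.
  by apply: xZ; apply: (subvP (algA_mono R d_gt0 kk)); exact: comm_gl_algA.
have Dcomm (j : 'I_n) (a b : 'I_d) : (c <= j)%N ->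
    (Dspan (glsum (left c) c) <= 'C[e j a b])%VS.
  move=> cj; apply/span_subvP => _ /imageP[[u v] _ ->]; apply/cent1vP/eqP.
  by rewrite -bracket_eq0 bracket_gl_sum_unit_op.
have {}xG := subvP (agenv_extend uM (sum_unit_op R d_gt0 c)
  (fun a b => Dcomm c a b (leqnn c))) _ xG.
(* By definition [agenv] is the sum of the powers below the dimension of the algebra, so [xG] places
   [x] in a [level]. *)
apply: (invariant_level d_gt0 ev bs uM (sum_unit_op R d_gt0 c) _ _ xG)
  => [z zD zC|y yM|a b].
(* Words in [glsum] commute with the algebra of the first [c] columns; an invariant one also belongs
   to that algebra, hence to its center. *)
- apply: (subvP cM); apply: (subvP (IH k' erefl)); apply/memv_capP; split.
    have zC' (a b : 'I_d) : bracket (glsum (left c) k' a b) z = 0 := zC a b.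
    apply: (comm_gl_algA d_gt0); apply: (comm_gl_of_side zC') => j a b cj.
    have De a' b' u v : bracket (glsum (left c) c a' b') (e j u v) = 0.
      exact: bracket_gl_sum_unit_op.
    exact: (agenv_Dspan_comm_e De a b zD).
  apply/centvP => y /(algA_comm_gl d_gt0) yc.
  suff /subvP/(_ z zD)/cent1vP : (agenv (Dspan (glsum (left c) c)) <= 'C[y])%VS by [].
  apply: agenv_sub_modl; first by rewrite -memvE cent1v1.
  apply/prodvP => u v uD vC; apply: memvM => //; move: u uD; apply/subvP/span_subvP.
  move=> _ /imageP[[a b] _ ->] /=; apply/cent1vP/eqP; rewrite -bracket_eq0.
  by rewrite (comm_gl_side _ yc).
- have -> : omega (glsum (left c) c) (e c) = JA c - wall_shift R d c *: 1.
    by rewrite JA_omega // addrK.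
  by rewrite JM_algebraM // rpredB ?mem_JM_algebra // rpredZ // JM_algebra1.
rewrite -gl_sum_side.
have := comm_gl_side (left c) (algA_comm_gl d_gt0 xA) a b.
by rewrite km.
Qed.

Lemma comm_of_bracket (A : falgType R[i]) (u v : A) : bracket u v = 0 -> u * v = v * u.
Proof. by move/eqP; rewrite bracket_eq0 => /eqP. Qed.

Lemma additively_central_JA : additively_central algA JA.
Proof.
move=> c; rewrite memv_cap; apply/andP; split.
  rewrite rpred_sum // => i ic.
  apply: (subvP (algA_mono R d_gt0 _)) (JA_algA R d_gt0 i).
  by rewrite /= /bump !leq0n !add1n.
apply/centvP => y /(algA_comm_gl d_gt0)[yD _].
have [s ->] := sum_JA_casimir R d_gt0 (ltn_ord c).
rewrite mulrDl mulrDr -!scalerAl -!scalerAr mul1r mulr1; congr (_ *: _ + _).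
apply/cent1vP; rewrite /casimir rpred_sum // => a _; rewrite rpred_sum // => b _.
by apply: memvM; apply/cent1vP/comm_of_bracket; have := yD a b; have := yD b a;
  rewrite /= /bump leq0n add1n.
Qed.

(** The element is the difference of two consecutive partial sums, both central; for [c = 0] the
    second one is empty. *)
Lemma JA_gelfand_tsetlin c : JA c \in gelfand_tsetlin algA (lift ord0 c).
Proof.
have cen i : (i <= c)%N ->
    \sum_(j < n | (j <= i)%N) JA j \in gelfand_tsetlin algA (lift ord0 c).
  move=> ic; apply: (subvP (sub_agenv _)).
  apply: (subvP (sumv_sup (lift ord0 i) _ (subvv _))) (additively_central_JA i).
  by rewrite /= /bump !leq0n !add1n.
have := cen c (leqnn c); rewrite (bigD1 c) //= => h.
rewrite -[JA c](addrK (\sum_(j < n | (j <= c)%N && (j != c)) JA j)) rpredB //.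
case: (posnP c) => [c0|c0].
  by rewrite big_pred0 ?mem0v // => j; rewrite -val_eqE /= c0 leqn0 andbN.
have c1 : (c.-1 < n)%N by rewrite (leq_ltn_trans (leq_pred _)).
have := cen (Ordinal c1) (leq_pred _).
rewrite (eq_bigl (fun j : 'I_n => (j <= c)%N && (j != c))) // => j.
by rewrite /= andbC -val_eqE -ltn_neqAle -ltnS prednK.
Qed.

Lemma separating_JA : separating algA JA.
Proof.
move=> c; apply/eqP; rewrite eqEsubv; apply/andP; split.
  rewrite /gelfand_tsetlin -[X in (_ <= X)%VS]agenv_id; apply: agenvS.
  apply/subv_sumP => k /andP[_]; rewrite /= /bump leq0n add1n => kc.
  exact: subv_trans (center_JM_algebra (erefl (k : nat))) (JM_algebra_mono kc).
rewrite -[X in (_ <= X)%VS]agenv_id; apply: agenvS; apply/span_subvP => _ /mapP[i + ->].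
rewrite mem_filter => /andP[ic _].
apply: (subvP (agenvS _)) (JA_gelfand_tsetlin i); apply/subv_sumP => k.
rewrite /= /bump !leq0n !add1n => /andP[k0 ki].
by apply: (sumv_sup k); rewrite // k0 (leq_trans ki).
Qed.

End GelfandTsetlin.

Theorem theorem5p6 (R : realType) (p q d : nat)
  (hpq : (1 <= p + q)%N) (hd : (2 <= d)%N) :
  jucys_murphy (@algA R p q d) (@JA R p q d).
Proof.
have d_gt0 : (0 < d)%N by exact: ltnW.
split; [|exact: additively_central_JA|exact: separating_JA].
by move=> c; exact: JA_gelfand_tsetlin.
Qed.
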